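(* Suppose we observe $n$ i.i.d. samples of $(X_1,\ldots,X_p,Y)$, where $X_1,\ldots,X_p$ are arbitrary random variables (with arbitrary joint distribution) and $Y$ is a Gaussian random variable independent of $(X_1,\ldots,X_p)$. Let $M_{XY}=\max_{1\le j\le p}|\hat C(X_j,Y)|$ be the maximal absolute sample correlation. Then for every $\delta>0$, as $p\to\infty$, $$\sup_{n\ge 3}\ \mathbb{P}\Big(M_{XY}>\sqrt{(1+\delta)(1-p^{-2/(n-2)})}\Big)\to 0.$$ In particular, if also $n\to\infty$, then one has the double limit $$\lim_{p,n\to\infty}\mathbb{P}\Big(M_{XY}\le\sqrt{1-p^{-2/(n-2)}}\Big)=1.$$
   Context: For random variables $X,Y$ with $n$ i.i.d. observations $(X_i,Y_i)$, $i=1,\dots,n$, and sample means $\bar X,\bar Y$, the (Pearson) sample correlation is $$\hat C(X,Y)=\frac{\sum_{i=1}^n(X_i-\bar X)(Y_i-\bar Y)}{\sqrt{\sum_{i=1}^n(X_i-\bar X)^2}\sqrt{\sum_{i=1}^n(Y_i-\bar Y)^2}}.$$ Sample correlations are assumed to be well defined, i.e. the denominators are almost surely nonzero (in particular $Y$ has positive variance). The notation $\lim_{p,n\to\infty}$ denotes the double limit as $p$ and $n$ tend to infinity jointly, with no restriction on their relative rates. *)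

(* Defs.v *)
From HB Require Import structures.
From mathcomp Require Import all_boot all_order all_algebra.
From mathcomp Require Import all_classical all_reals all_analysis.

Set Implicit Arguments.
Unset Strict Implicit.
Unset Printing Implicit Defensive.

Import Order.TTheory GRing.Theory Num.Theory.
Import numFieldNormedType.Exports.

Local Open Scope classical_set_scope.
Local Open Scope ring_scope.

Section sample_correlation.
Context {R : realType} {n : nat}.
Implicit Types x y : 'I_n -> R.

Definition sample_mean x : R := (\sum_(i < n) x i) / n%:R.

Definition corr_denominator x y : R :=
  Num.sqrt (\sum_(i < n) (x i - sample_mean x) ^+ 2) *
  Num.sqrt (\sum_(i < n) (y i - sample_mean y) ^+ 2).

Definition sample_corr x y : R :=
  (\sum_(i < n) (x i - sample_mean x) * (y i - sample_mean y)) /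
  corr_denominator x y.

(* The neutral value 0 of the maximum is harmless: absolute values are
   nonnegative, so for p >= 1 this is the maximum over the p columns. *)
Definition max_abs_corr {p : nat} (x : 'I_n -> 'I_p -> R) y : R :=
  \big[Num.max/0]_(j < p) `|sample_corr (fun i => x i j) y|.

End sample_correlation.

Section random_vectors.
Context {R : realType}.

(* Tuples carry the product sigma-algebra; the identity coercion to
   [measurableTypeR R] selects the Borel sigma-algebra on each coordinate. *)
Definition covariates {T : Type} {p : nat} (X : 'I_p -> T -> R) (t : T) :
    p.-tuple (measurableTypeR R) :=
  [tuple X j t | j < p].

Definition observation {T : Type} {p : nat} (X : 'I_p -> T -> R) (Y : T -> R)
    (t : T) : (p.-tuple (measurableTypeR R) * measurableTypeR R)%type :=
  (covariates X t, Y t).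

End random_vectors.

Section independence.
Context {R : realType} {d : measure_display} {T : measurableType d}.
Variable P : probability T R.
Local Open Scope ereal_scope.

Definition independent_pair {d1 d2 : measure_display}
    {V1 : measurableType d1} {V2 : measurableType d2}
    (f : T -> V1) (g : T -> V2) : Prop :=
  forall (A : set V1) (B : set V2), measurable A -> measurable B ->
    P (f @^-1` A `&` g @^-1` B) = P (f @^-1` A) * P (g @^-1` B).

Definition mutually_independent {I : finType} {d1 : measure_display}
    {V : measurableType d1} (f : I -> T -> V) : Prop :=
  forall (J : {set I}) (A : I -> set V),
    (forall i, i \in J -> measurable (A i)) ->
    P (\bigcap_(i in [set` J]) (f i @^-1` A i)) =
    \prod_(i in J) P (f i @^-1` A i).

End independence.

Definition same_law {R : realType} {d d' d1 : measure_display}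
    {T : measurableType d} {T' : measurableType d'} {V : measurableType d1}
    (P : probability T R) (P' : probability T' R)
    (f : T -> V) (f' : T' -> V) : Prop :=
  forall A : set V, measurable A -> P (f @^-1` A) = P' (f' @^-1` A).

(* [Z] is an i.i.d. sample, living on its own probability space [(T, P)], of
   the random element [Z0] defined on [(T0, P0)]. *)
Definition iid_sample {R : realType} {d0 d d1 : measure_display}
    {T0 : measurableType d0} {T : measurableType d} {V : measurableType d1}
    (P0 : probability T0 R) (Z0 : T0 -> V)
    (P : probability T R) (n : nat) (Z : 'I_n -> T -> V) : Prop :=
  mutually_independent P Z /\ forall i, same_law P P0 (Z i) Z0.

(* [s] is the standard deviation.  Positivity is required because the library's
   [normal_prob m 0] is by convention a uniform law, not a point mass. *)
Definition gaussian {R : realType} {d : measure_display} {T : measurableType d}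
    (P : probability T R) (Y : {RV P >-> R}) : Prop :=
  exists m s : R, 0 < s /\
    forall A : set (measurableTypeR R), measurable A ->
      distribution P Y A = normal_prob m s A.

(* Main.v *)
(* Given the covariates, rotations turn the squared correlation of one column
   with the Gaussian response into Z_1^2 / (Z_1^2 + V), where Z_1 is standard
   normal and V is an independent chi-square variable with n - 2 degrees of
   freedom.  The Gaussian tail bound P(|Z_1| > w) <= exp(-w^2/2) min(2, 1/w),
   integrated against the law of V, gives
     P(|C| > r) <= (1 - r^2)^((n-2)/2) * 12 / (r sqrt(n-2)).
   For r^2 = 1 - p^(-2/(n-2)) the first factor is exactly 1/p, so the union
   bound over the p columns leaves 12 / (r sqrt(n-2)), and
   1/(r^2 (n-2)) <= 1/(2 ln p) + 1/(n-2).  This gives the double limit.  With the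
   factor 1 + delta, either the threshold is at least 1 and the event is empty,
   or 1/(n-2) = O(1/ln p), which makes the bound uniform in n. *)

From HB Require Import structures.
Require Import Defs.
From mathcomp Require Import all_boot all_order all_algebra.
From mathcomp Require Import all_classical all_reals all_analysis.
From mathcomp Require Import measurable_realfun ring lra.

Set Implicit Arguments.
Unset Strict Implicit.
Unset Printing Implicit Defensive.

Import Order.TTheory GRing.Theory Num.Theory.
Import numFieldNormedType.Exports.

Local Open Scope classical_set_scope.
Local Open Scope ring_scope.

(** * Lebesgue measure and the normal law *)

(** With the bound [2 exp(-w^2/2)] alone the method fails by a constant: integrated against the law
    of [V] it gives [2/p] per column, and the union bound leaves 2. All convergence to 0 comes from
    the factor [1/w], which is of order [1/(r sqrt(n-2))] when [V] has its typical size but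
    worthless when [V] is small. Hence the integration over [V] is split. The typical range
    contributes 2 to the constant 12; the small range is exponentially unlikely in [n - 2] after
    tilting and contributes 10. Throughout, [V] stays a sum of [k] squares and enters only through
    [E exp(-(c-1)V/2) = c^(-k/2)], taken at two values of [c].

    Rotation invariance is obtained one coordinate plane at a time, so that it rests on translation
    invariance on the line and Fubini. Finitely many plane rotations bring the vector of ones and
    the centered column to two axes. They depend on the column, so they are applied with the
    covariates frozen; the resulting bound is the same for all frozen values and survives
    integration over them. *)

Section image_measure.
Context d1 d2 (T1 : measurableType d1) (T2 : measurableType d2) {R : realType}.

(* A copy of [pushforward] that carries the measurability proof, so that its
   measure structure can be inferred. *)
Definition image_measure (m : set T1 -> \bar R) (f : T1 -> T2)
  & measurable_fun setT f := pushforward m f.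

HB.instance Definition _ (m : {measure set T1 -> \bar R}) f mf :=
  Measure.copy (@image_measure m f mf)
    (measure_function_pushforward__canonical__measure_function_Measure m mf).

Lemma image_measure_setT (m : probability T1 R) (f : T1 -> T2)
    (mf : measurable_fun setT f) :
  image_measure m mf setT = 1%E.
Proof. by rewrite /image_measure /pushforward preimage_setT probability_setT. Qed.

HB.instance Definition _ (m : probability T1 R) (f : T1 -> T2)
    (mf : measurable_fun setT f) :=
  @Measure_isProbability.Build _ _ _ (image_measure m mf)
    (image_measure_setT m mf).

Lemma ge0_integral_image_measure (m : {measure set T1 -> \bar R}) (f : T1 -> T2)
    (mf : measurable_fun setT f) (g : T2 -> \bar R) :
  measurable_fun setT g -> (forall y, (0 <= g y)%E) ->
  (\int[image_measure m mf]_y g y = \int[m]_x g (f x))%E.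
Proof. by move=> mg g0; rewrite /image_measure ge0_integral_pushforward//. Qed.

End image_measure.

Section lebesgue_affine.
Context {R : realType}.
Notation mu := (@lebesgue_measure R).
Local Open Scope ereal_scope.

(** Both sides are measures in [A], and they agree on half-open intervals, which determine Lebesgue
    measure. *)
Lemma lebesgue_measure_affine (a b : R) (A : set R) : (0 < a)%R ->
  measurable A ->
  mu A = a%:E * mu ((fun x : R => a * x + b)%R @^-1` A).
Proof.
move=> a0 mA.
have mphi : measurable_fun [set: measurableTypeR R]
    (fun x : measurableTypeR R => (a * x + b)%R : measurableTypeR R).
  by apply: measurable_funD => //; exact: measurable_funM.
pose nu := mscale (NngNum (ltW a0)) (image_measure mu mphi).
have -> : a%:E * mu ((fun x : R => a * x + b)%R @^-1` A) = nu A by [].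
apply: lebesgue_measure_unique => // X /ocitvP[->|[[u v]/= uv ->]].
  by rewrite !measure0.
rewrite /nu /mscale /= /image_measure /pushforward.
have -> : (fun x : R => a * x + b)%R @^-1` `]u, v] =
    `]((u - b) / a)%R, ((v - b) / a)%R]%classic.
  apply/seteqP; split => x /=; rewrite !in_itv/= ltr_pdivrMr// ler_pdivlMr//;
  by rewrite (mulrC x) ltrBlDr lerBrDr.
rewrite !lebesgue_measure_itv/= !lte_fin ltr_pM2r ?invr_gt0// ltrD2r.
case: ifP => _; last by rewrite mule0.
rewrite -!EFinD -EFinM; congr EFin; field; exact: lt0r_neq0.
Qed.

Lemma ge0_integral_affine (a b : R) (f : measurableTypeR R -> \bar R) : (0 < a)%R ->
  measurable_fun setT f -> (forall x, 0 <= f x) ->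
  \int[mu]_x f x = a%:E * \int[mu]_x f (a * x + b)%R.
Proof.
move=> a0 mf f0.
have mphi : measurable_fun [set: measurableTypeR R]
    (fun x : measurableTypeR R => (a * x + b)%R : measurableTypeR R).
  by apply: measurable_funD => //; exact: measurable_funM.
pose nu := mscale (NngNum (ltW a0)) (image_measure mu mphi).
rewrite (eq_measure_integral nu); last first.
  by move=> A mA _; exact: lebesgue_measure_affine.
rewrite ge0_integral_mscale//=.
by rewrite ge0_integral_image_measure.
Qed.

End lebesgue_affine.

Section normal_prob.
Import HBNNSimple.
Context {R : realType}.
Notation mu := (@lebesgue_measure R).
Local Open Scope ereal_scope.

(** [normal_prob] is defined by integrating its density over sets, so the identity holds for
    indicators; simple functions and monotone convergence carry it to [f]. *)
Lemma ge0_integral_normal_prob (m s : R) (f : measurableTypeR R -> \bar R) :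
  measurable_fun setT f -> (forall x, 0 <= f x) ->
  \int[normal_prob m s]_x f x = \int[mu]_x (f x * (normal_pdf m s x)%:E).
Proof.
move=> mf f0.
have mpdf : measurable_fun setT (fun x : measurableTypeR R => (normal_pdf m s x)%:E).
  by apply/measurable_EFinP; exact: measurable_normal_pdf.
have pdf0 x : 0 <= (normal_pdf m s x)%:E by rewrite lee_fin normal_pdf_ge0.
pose f_ := nnsfun_approx measurableT mf.
transitivity (limn (fun n => \int[normal_prob m s]_x (f_ n x)%:E)).
  rewrite -monotone_convergence//=.
  - apply: eq_integral => ? /[!inE] xD; apply/esym/cvg_lim => //=.
    exact: cvg_nnsfun_approx.
  - by move=> n; exact/measurable_EFinP/measurable_funTS.
  - by move=> n ? _; rewrite lee_fin.
  - by move=> ? _ ? ? mn; rewrite lee_fin; exact/lefP/nd_nnsfun_approx.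
transitivity (limn (fun n => \int[mu]_x ((f_ n x)%:E * (normal_pdf m s x)%:E))).
  congr (limn _); apply/funext => n.
  under [LHS]eq_integral do rewrite fimfunE -fsumEFin//.
  rewrite [LHS]ge0_integral_fsum//; last 2 first.
  - by move=> r; exact/measurable_EFinP/measurableT_comp.
  - by move=> r x _; rewrite EFinM nnfun_muleindic_ge0.
  under [RHS]eq_integral.
    move=> x xD; rewrite fimfunE -fsumEFin// ge0_mule_fsuml; last first.
      by move=> r; rewrite EFinM nnfun_muleindic_ge0.
    over.
  rewrite [RHS]ge0_integral_fsum//; last 2 first.
  - move=> r; apply: emeasurable_funM => //.
    exact/measurable_EFinP/measurableT_comp.
  - by move=> r x _; rewrite mule_ge0// EFinM nnfun_muleindic_ge0.
  apply: eq_fsbigr => r; rewrite inE => -[t _ <-].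
  have r0 : (0 <= f_ n t)%R by [].
  under eq_integral do rewrite EFinM.
  rewrite ge0_integralZl//; last exact/measurable_EFinP/measurable_indic.
  under [RHS]eq_integral do rewrite EFinM -muleA.
  rewrite ge0_integralZl//=; last 2 first.
  - apply: emeasurable_funM => //.
    exact/measurable_EFinP/measurable_indic.
  - by move=> x _; rewrite mule_ge0// lee_fin.
  congr (_ * _).
  rewrite integral_indic// setIT.
  transitivity (\int[mu]_(x in f_ n @^-1` [set f_ n t]) (normal_pdf m s x)%:E).
    by [].
  rewrite integral_mkcond/=.
  apply: eq_integral => x _; rewrite patchE indicE.
  by case: ifP; rewrite ?mul1e ?mul0e.
rewrite -monotone_convergence//=.
- apply: eq_integral => x _; apply/cvg_lim => //=.
  apply: cvgeZr => //; first exact: cvg_nnsfun_approx.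
- move=> n; apply: emeasurable_funM => //.
  exact/measurable_EFinP/measurable_funTS.
- by move=> n x _; rewrite mule_ge0// lee_fin.
- move=> x _ i j ij; rewrite lee_wpmul2r// lee_fin.
  exact/lefP/nd_nnsfun_approx.
Qed.

End normal_prob.

Section standard_normal.
Context {R : realType}.
Notation mu := (@lebesgue_measure R).
Implicit Types (x w s b : R) (A : set (measurableTypeR R)).

Lemma normal_peakM s : 0 < s -> normal_peak s = s^-1 * normal_peak 1.
Proof.
move=> s0; rewrite /normal_peak expr1n mul1r -mulrnAr sqrtrM ?sqr_ge0//.
by rewrite sqrtr_sqr gtr0_norm// invfM.
Qed.

Lemma normal_pdf1E x : normal_pdf 0 1 x = normal_peak 1 * expR (- (x ^+ 2 / 2)).
Proof.
by rewrite normal_pdfE ?oner_neq0// /normal_fun subr0 expr1n mulNr.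
Qed.

Lemma normal_pdf_standardize m s x : 0 < s ->
  normal_pdf m s x = s^-1 * normal_pdf 0 1 (s^-1 * x + - (s^-1 * m)).
Proof.
move=> s0; rewrite normal_pdf1E normal_pdfE ?gt_eqF// normal_peakM// -mulrA.
congr (_ * (_ * expR _)); rewrite /normal_fun -mulr_natr; field.
exact: lt0r_neq0.
Qed.

Lemma measurable_normal_pdf_restrict m s A : measurable A ->
  measurable_fun setT ((fun x : measurableTypeR R => (normal_pdf m s x)%:E) \_ A).
Proof.
move=> mA; apply/(measurable_restrictT _ _).1 => //; apply: measurable_funTS.
by apply/measurable_EFinP; exact: measurable_normal_pdf.
Qed.

Lemma normal_prob_standardize m s A : 0 < s -> measurable A ->
  normal_prob m s ((fun y => (y - m) / s) @^-1` A) = normal_prob 0 1 A.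
Proof.
move=> s0 mA; rewrite /normal_prob integral_mkcond [RHS]integral_mkcond.
have s1 : 0 < s^-1 by rewrite invr_gt0.
rewrite [RHS](ge0_integral_affine (- (s^-1 * m)) s1); last 2 first.
- exact: measurable_normal_pdf_restrict.
- by move=> x; rewrite erestrict_ge0// => y _; rewrite lee_fin normal_pdf_ge0.
rewrite -ge0_integralZl//; last 3 first.
- apply: (measurableT_comp (measurable_normal_pdf_restrict 0 1 mA)).
  by apply: measurable_funD => //; exact: measurable_funM.
- by move=> x _; rewrite erestrict_ge0// => y _; rewrite lee_fin normal_pdf_ge0.
- by rewrite lee_fin ltW.
apply: eq_integral => x _; rewrite !patchE.
have -> : (x \in (fun y => (y - m) / s) @^-1` A) = (s^-1 * x + - (s^-1 * m) \in A).
  apply/idP/idP; rewrite !inE/=; congr (A _); ring.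
by case: ifP => _; rewrite ?mule0// normal_pdf_standardize// EFinM.
Qed.

(** The integrand times the standard density is [1 / sqrt b] times the centered density of variance
    [1 / b]. The parameter is [b] rather than [b - 1] because tilting turns variance 1 into
    [1 / b]. *)
Lemma integral_normal_expR b : 0 < b ->
  (\int[normal_prob 0 1]_x (expR (- ((b - 1) * x ^+ 2 / 2)))%:E =
   (Num.sqrt b)^-1%:E)%E.
Proof.
move=> b0.
have sb0 : 0 < (Num.sqrt b)^-1 by rewrite invr_gt0 sqrtr_gt0.
rewrite ge0_integral_normal_prob; last 2 first.
- apply/measurable_EFinP; apply: measurableT_comp => //.
  apply: measurableT_comp => //; apply: measurable_funM => //.
  by apply: measurable_funM => //; exact: measurable_funX.
- by move=> x; rewrite lee_fin expR_ge0.
under eq_integral => x _.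
  rewrite -EFinM [X in X%:E]
    (_ : _ = (Num.sqrt b)^-1 * normal_pdf 0 (Num.sqrt b)^-1 x); last first.
    rewrite normal_pdf1E normal_pdfE ?gt_eqF// (normal_peakM sb0) invrK.
    rewrite -[X in _ = _ * X]mulrA mulKf ?gt_eqF ?sqrtr_gt0//.
    rewrite mulrCA -expRD; congr (_ * expR _).
    rewrite subr0 exprVn sqr_sqrtr ?ltW// -mulr_natr; field.
    exact: lt0r_neq0.
  rewrite EFinM.
  over.
rewrite ge0_integralZl//= ?integral_normal_pdf ?mule1//.
- by apply/measurable_EFinP; exact: measurable_normal_pdf.
- by move=> x _; rewrite lee_fin normal_pdf_ge0.
Qed.

Lemma normal_probN A : measurable A ->
  normal_prob 0 1 (-%R @^-1` A) = normal_prob 0 1 A.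
Proof.
move=> mA.
have mN : measurable_fun [set: measurableTypeR R]
    (-%R : measurableTypeR R -> measurableTypeR R) by [].
rewrite /normal_prob integral_mkcond [RHS]integral_mkcond.
rewrite [RHS](eq_measure_integral (image_measure mu mN)); last first.
  by move=> B mB _; exact/esym/lebesgue_measureN.
rewrite ge0_integral_image_measure; last 2 first.
- exact: measurable_normal_pdf_restrict.
- by move=> x; rewrite erestrict_ge0// => y _; rewrite lee_fin normal_pdf_ge0.
apply: eq_integral => x _; rewrite !patchE !normal_pdf1E sqrrN.
have -> : (x \in -%R @^-1` A) = (- x \in A) by apply/idP/idP; rewrite !inE.
by [].
Qed.

Lemma is_derive_normal_pdf x :
  is_derive x 1 (normal_pdf 0 1 : R -> R) (- (x * normal_pdf 0 1 x)).
Proof.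
have -> : (normal_pdf 0 1 : R -> R) = fun y => normal_peak 1 * expR (- (y ^+ 2 / 2)).
  by apply/funext => y; exact: normal_pdf1E.
apply: is_derive_eq.
by rewrite /GRing.scale/=; field.
Qed.

Lemma normal_pdf_cvg0 : normal_pdf 0 1 x @[x --> +oo%R] --> (0 : R).
Proof.
have -> : (normal_pdf 0 1 : R -> R) = fun y => normal_peak 1 * expR (- (y ^+ 2 / 2)).
  by apply/funext => y; exact: normal_pdf1E.
rewrite -[X in _ --> X](mulr0 (normal_peak 1 : R)); apply: cvgM; first exact: cvg_cst.
apply: (@cvg_comp _ _ _ (fun y : R => y ^+ 2 / 2) (fun z => expR (- z)) _ +oo%R);
  last exact: cvgr_expR.
apply/cvgryPge => A; near=> y.
have y1 : 1 <= y by near: y; apply: nbhs_pinfty_ge; exact: num_real.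
have yA : 2 * A <= y by near: y; apply: nbhs_pinfty_ge; exact: num_real.
nra.
Unshelve. all: by end_near. Qed.

Lemma integral_id_normal_pdf w : 0 <= w ->
  (\int[mu]_(x in `[w, +oo[) (x * normal_pdf 0 1 x)%:E = (normal_pdf 0 1 w)%:E)%E.
Proof.
move=> w0.
have cpdf : continuous (normal_pdf 0 1 : R -> R).
  by apply: continuous_normal_pdf; exact: oner_neq0.
have dN x : is_derive x 1 (fun y => - normal_pdf 0 1 y : R) (x * normal_pdf 0 1 x).
  have dx := is_derive_normal_pdf x.
  by apply: is_derive_eq; rewrite opprK.
rewrite (@ge0_continuous_FTC2y _ _ (fun x => - normal_pdf 0 1 x) _ 0).
- by rewrite sub0e EFinN oppeK.
- by move=> x wx; rewrite mulr_ge0 ?normal_pdf_ge0// (le_trans w0).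
- by apply: continuous_subspaceT => x; apply: cvgM; [exact: cvg_id|exact: cpdf].
- by rewrite -[X in _ --> X]oppr0; apply: cvgN; exact: normal_pdf_cvg0.
- by move=> x _; exact: ex_derive.
- by apply/cvg_at_right_filter; apply: cvgN; exact: cpdf.
- by move=> x _; rewrite derive1E; apply: derive_val.
Qed.

(** Follows from [pi >= 2]. It lets the two one-sided tails add up to [exp(-w^2/2) / w] with
    constant 1. *)
Lemma normal_peak1_le : normal_peak 1 <= 2^-1 :> R.
Proof.
rewrite /normal_peak expr1n mul1r lef_pV2 ?posrE ?sqrtr_gt0//; last first.
  by rewrite pmulrn_lgt0// pi_gt0.
rewrite -[leLHS](ger0_norm (ler0n R 2)) -sqrtr_sqr ler_sqrt.
  by have := pi_ge2 R; rewrite -mulr_natr; nra.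
by rewrite pmulrn_lge0// pi_ge0.
Qed.

(** Mills' inequality: for [x >= w] the density is at most [x / w] times itself, and the latter has
    an explicit primitive. *)
Lemma normal_prob_tail w : 0 < w ->
  (normal_prob 0 1 [set x : measurableTypeR R | (w <= `|x|)%R] <=
   (expR (- (w ^+ 2 / 2)) / w)%:E)%E.
Proof.
move=> w0.
have mW : measurable (`[w, +oo[%classic : set (measurableTypeR R)) by exact: measurable_itv.
have mpos : (normal_prob 0 1 (`[w, +oo[%classic : set (measurableTypeR R)) <=
    (expR (- (w ^+ 2 / 2)) / (2 * w))%:E)%E.
  apply: (@le_trans _ _
    (\int[mu]_(x in `[w, +oo[) ((w^-1)%:E * (x * normal_pdf 0 1 x)%:E))%E).
    apply: ge0_le_integral => //=.
    - by move=> x _; rewrite lee_fin normal_pdf_ge0.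
    - apply/measurable_EFinP/measurable_funTS; exact: measurable_normal_pdf.
    - apply/measurable_EFinP/measurable_funTS; apply: measurable_funM => //.
      by apply: measurable_funM => //; exact: measurable_normal_pdf.
    - move=> x; rewrite in_itv/= andbT => wx; rewrite lee_fin mulrA.
      by rewrite ler_peMl ?normal_pdf_ge0// mulrC ler_pdivlMr// mul1r.
  rewrite ge0_integralZl//=; last 3 first.
  - apply/measurable_EFinP/measurable_funTS.
    by apply: measurable_funM => //; exact: measurable_normal_pdf.
  - move=> x; rewrite in_itv/= andbT => wx.
    by rewrite lee_fin mulr_ge0 ?normal_pdf_ge0// ltW// (lt_le_trans w0).
  - by rewrite lee_fin invr_ge0 ltW.
  rewrite integral_id_normal_pdf ?(ltW w0)// -EFinM lee_fin normal_pdf1E invfM.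
  rewrite [leLHS]mulrA [leRHS]mulrC ler_wpM2r ?expR_ge0//.
  by rewrite mulrC ler_wpM2r ?normal_peak1_le// invr_ge0 (ltW w0).
have -> : [set x : measurableTypeR R | (w <= `|x|)%R] =
    `[w, +oo[%classic `|` (-%R @^-1` `[w, +oo[%classic).
  apply/seteqP; split => x /=; rewrite !in_itv/= !andbT ler_normr.
    by move/orP.
  by move=> H; apply/orP.
apply: (le_trans (measureU2 _ _ _)) => //.
  rewrite -[X in measurable X]setTI.
  by have mN : measurable_fun [set: measurableTypeR R]
      (-%R : measurableTypeR R -> measurableTypeR R); [by []|exact: mN].
have mneg := mpos; rewrite -normal_probN// in mneg.
apply: (le_trans (leeD mpos mneg)).
rewrite -EFinD lee_fin invfM -mulrDr; apply: ler_wpM2l; first exact: expR_ge0.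
by lra.
Qed.

(** For [w <= 1] the right side is at least [2 - w^2 >= 1]; for [w > 1] Mills' inequality is
    stronger. This version stays finite at [w = 0], as the range of small [V] requires. *)
Lemma normal_prob_tail2 w : 0 <= w ->
  (normal_prob 0 1 [set x : measurableTypeR R | (w <= `|x|)%R] <=
   (2 * expR (- (w ^+ 2 / 2)))%:E)%E.
Proof.
move=> w0; have [w1|w1] := leP w 1.
  apply: (@le_trans _ _ 1%E).
    apply: probability_le1.
    have -> : [set x : measurableTypeR R | (w <= `|x|)%R] =
        setT `&` (fun x : measurableTypeR R => `|x|) @^-1` `[w, +oo[%classic.
      by rewrite setTI; apply/seteqP; split => x /=; rewrite in_itv/= andbT.
    have mn : measurable_fun [set: measurableTypeR R]
        (fun x : measurableTypeR R => `|x| : measurableTypeR R).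
      exact: normr_measurable.
    by apply: mn => //; exact: measurable_itv.
  rewrite lee_fin.
  have := expR_ge1Dx (- (w ^+ 2 / 2)); nra.
apply: (le_trans (normal_prob_tail _)); first exact: lt_trans w1.
rewrite lee_fin mulrC ler_wpM2r ?expR_ge0//.
rewrite (@le_trans _ _ 1) ?ler1n// invf_le1 ?ltW//.
by rewrite (lt_trans _ w1).
Qed.

End standard_normal.

(** * Rotation invariance of the planar Gaussian measure *)

Section rotation.
Context {R : realType}.
Notation mu := (@lebesgue_measure R).
Notation mR := (measurableTypeR R).
Local Open Scope ereal_scope.
Implicit Types (F : mR * mR -> \bar R).

Lemma ge0_integral_shear1 (t : R) F : measurable_fun setT F -> (forall z, 0 <= F z) ->
  \int[mu]_x \int[mu]_y F (x, (y + t * x)%R) = \int[mu]_x \int[mu]_y F (x, y).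
Proof.
move=> mF F0; apply: eq_integral => x _.
rewrite [RHS](ge0_integral_affine (t * x)%R (@ltr01 R)) ?mul1e//.
- by apply: eq_integral => y _; rewrite mul1r.
- by apply: measurableT_comp => //; exact: measurable_pair1.
Qed.

(** The shear moves the outer variable; exchanging the integrals turns it into a translation of the
    inner one. *)
Lemma ge0_integral_shear2 (t : R) F : measurable_fun setT F -> (forall z, 0 <= F z) ->
  \int[mu]_x \int[mu]_y F ((x + t * y)%R, y) = \int[mu]_x \int[mu]_y F (x, y).
Proof.
move=> mF F0.
have mG : measurable_fun setT (fun z : mR * mR => F ((z.1 + t * z.2)%R, z.2)).
  apply: (measurableT_comp mF); apply: measurable_fun_pair => //=.
  by apply: measurable_funD => //; exact: measurable_funM.
transitivity (\int[mu]_y \int[mu]_x F ((x + t * y)%R, y)).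
  exact: (sfinite_Fubini mu mu (fun z : mR * mR => F ((z.1 + t * z.2)%R, z.2))).
transitivity (\int[mu]_y \int[mu]_x F (x, y)); last first.
  exact/esym/(sfinite_Fubini mu mu F).
apply: eq_integral => y _.
rewrite [RHS](ge0_integral_affine (t * y)%R (@ltr01 R)) ?mul1e//.
- by apply: eq_integral => x _; rewrite mul1r.
- by apply: measurableT_comp => //; exact: measurable_pair2.
Qed.

Definition rotation (c s : R) (z : mR * mR) : mR * mR :=
  ((c * z.1 + s * z.2)%R, (- s * z.1 + c * z.2)%R).

Lemma measurable_rotation (c s : R) : measurable_fun setT (rotation c s).
Proof.
by apply: measurable_fun_pair => /=; apply: measurable_funD => //;
  exact: measurable_funM.
Qed.

(* A rotation by an angle that is not a multiple of pi is a product of three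
   shears, each of which preserves Lebesgue measure by translation invariance. *)
Lemma ge0_integral_rot (c s : R) F : s != 0%R -> (c ^+ 2 + s ^+ 2 = 1)%R ->
  measurable_fun setT F -> (forall z, 0 <= F z) ->
  \int[mu]_x \int[mu]_y F (rotation c s (x, y)) = \int[mu]_x \int[mu]_y F (x, y).
Proof.
(* For [c] and [s] the cosine and sine of an angle, [t] is the tangent of half that angle, and the
   rotation is [U] after [L] after [U]. *)
move=> s0 cs1 mF F0; pose t := ((1 - c) / s)%R.
pose U (z : mR * mR) : mR * mR := ((z.1 + t * z.2)%R, z.2).
pose L (z : mR * mR) : mR * mR := (z.1, (z.2 + - s * z.1)%R).
have mU : measurable_fun setT U.
  by apply: measurable_fun_pair => //=; apply: measurable_funD => //; exact: measurable_funM.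
have mL : measurable_fun setT L.
  by apply: measurable_fun_pair => //=; apply: measurable_funD => //; exact: measurable_funM.
have ts : (t * s = 1 - c)%R by rewrite divfK.
have rotE z : rotation c s z = U (L (U z)).
  have cE : (1 - t * s = c)%R by rewrite ts; ring.
  have sE : (t * (1 - t * s) + t = s)%R.
    apply: (mulIf s0); rewrite cE mulrDl mulrAC ts -expr2.
    by rewrite (_ : s ^+ 2 = 1 - c ^+ 2)%R; [ring|rewrite -cs1; ring].
  rewrite /rotation /U /L/=; congr pair.
    by rewrite -{1}sE -{1}cE; ring.
  by rewrite -{1}cE; ring.
under eq_integral do under eq_integral do rewrite rotE.
have mFU : measurable_fun setT (F \o U) by exact: measurableT_comp.
have mFUL : measurable_fun setT (F \o U \o L) by exact: measurableT_comp.
rewrite (ge0_integral_shear2 t mFUL (fun z => F0 _)).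
rewrite (ge0_integral_shear1 (- s) mFU (fun z => F0 _)).
exact: ge0_integral_shear2.
Qed.

Lemma normal_prob_prodE (C : set (mR * mR)) : measurable C ->
  (normal_prob 0 1 \x normal_prob 0 1) C =
  \int[mu]_x \int[mu]_y ((\1_C (x, y))%:E * (normal_pdf 0 1 x * normal_pdf 0 1 y)%:E).
Proof.
move=> mC; rewrite /product_measure1 ge0_integral_normal_prob//; last first.
  exact: measurable_fun_xsection.
apply: eq_integral => x _ /=.
rewrite /normal_prob integral_mkcond muleC -ge0_integralZl//; last 3 first.
- by apply: measurable_normal_pdf_restrict; exact: measurable_xsection.
- by move=> y _; rewrite erestrict_ge0// => ? _; rewrite lee_fin normal_pdf_ge0.
- by rewrite lee_fin normal_pdf_ge0.
apply: eq_integral => y _; rewrite patchE indicE.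
have -> : (y \in xsection C x) = ((x, y) \in C) by rewrite mem_xsection.
by case: ifP => _; rewrite ?mule0 ?mul0e// mul1e EFinM.
Qed.

(** The product density depends only on [x^2 + y^2], and the Lebesgue integral over the plane is
    rotation invariant. *)
Lemma normal_prob_prod_rot (c s : R) (C : set (mR * mR)) :
  s != 0%R -> (c ^+ 2 + s ^+ 2 = 1)%R -> measurable C ->
  (normal_prob 0 1 \x normal_prob 0 1) (rotation c s @^-1` C) =
  (normal_prob 0 1 \x normal_prob 0 1) C.
Proof.
move=> s0 cs1 mC.
have mrC : measurable (rotation c s @^-1` C).
  by rewrite -[X in measurable X]setTI; exact: measurable_rotation.
pose F (z : mR * mR) := (\1_C z)%:E * (normal_pdf 0 1 z.1 * normal_pdf 0 1 z.2)%:E.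
have mF : measurable_fun setT F.
  apply: emeasurable_funM; first exact/measurable_EFinP.
  apply/measurable_EFinP; apply: measurable_funM.
    by apply: measurableT_comp => //; exact: measurable_normal_pdf.
  by apply: measurableT_comp => //; exact: measurable_normal_pdf.
have F0 z : 0 <= F z by rewrite mule_ge0// lee_fin// mulr_ge0 ?normal_pdf_ge0.
apply: (etrans (normal_prob_prodE mrC)).
apply: (etrans _ (esym (normal_prob_prodE mC))).
apply: (etrans _ (ge0_integral_rot s0 cs1 mF F0)).
apply: eq_integral => x _; apply: eq_integral => y _.
congr (_ * _%:E) => /=.
rewrite !normal_pdf1E mulrACA -expRD [RHS]mulrACA -expRD; congr (_ * expR _)%R.
by move: cs1; nra.
Qed.

End rotation.

(** * Independence *)

Section tuple_measure.
Context {R : realType} {d : measure_display} {V : measurableType d} {n : nat}.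
Local Open Scope ereal_scope.

Lemma measurable_box (B : 'I_n -> set V) : (forall i, measurable (B i)) ->
  measurable [set x : n.-tuple V | forall i, B i (tnth x i)].
Proof.
move=> mB.
have -> : [set x : n.-tuple V | forall i, B i (tnth x i)] =
    \bigcap_(i in setT) (setT `&` (@tnth n V ^~ i) @^-1` B i).
  by apply/seteqP; split => x /= H i; [split => //; exact: H|have [] := H i].
apply: fin_bigcap_measurable => // i _.
exact: (measurable_tnth i).
Qed.

(** Boxes are stable under intersection and generate the product sigma-algebra. *)
Lemma tuple_measure_unique (m1 m2 : {measure set (n.-tuple V) -> \bar R}) :
  m1 setT < +oo ->
  (forall B : 'I_n -> set V, (forall i, measurable (B i)) ->
    m1 [set x | forall i, B i (tnth x i)] = m2 [set x | forall i, B i (tnth x i)]) ->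
  forall A, measurable A -> m1 A = m2 A.
Proof.
move=> m1fin m12 A mA.
pose G := [set C : set (n.-tuple V) | exists2 B : 'I_n -> set V,
  forall i, measurable (B i) & C = [set x | forall i, B i (tnth x i)]].
have GT : G setT by exists (fun=> setT) => //; apply/seteqP; split.
apply: (g_sigma_algebra_measure_unique G _ (fun=> setT)) => //.
- by move=> _ [B mB ->]; exact: measurable_box.
- by rewrite bigcup_const.
- move=> _ _ [B mB ->] [C mC ->]; exists (fun i => B i `&` C i).
    by move=> i; exact: measurableI.
  apply/seteqP; split => x /=; first by move=> [H1 H2] i; split.
  by move=> H; split => i; have [] := H i.
- by move=> _ [B mB ->]; exact: m12.
- move: A mA; apply: smallest_sub; first exact: smallest_sigma_algebra.
  move=> C; rewrite -bigcup_seq/= => -[i _ [D mD <-]].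
  apply: sub_sigma_algebra; exists (fun k => if k == i then D else setT).
    by move=> k; case: ifP.
  rewrite setTI; apply/seteqP; split => x /=.
    by move=> Dx k; case: eqP => // ->.
  by move=> /(_ i); rewrite eqxx.
Qed.

End tuple_measure.

Section independence.
Context {R : realType} {d : measure_display} {T : measurableType d}.
Variable P : probability T R.
Local Open Scope ereal_scope.

(** For fixed [E] both sides are finite measures in [A] that agree on boxes. Applied twice, once per
    tuple, it lifts independence from boxes to all events. *)
Lemma tuple_indep_event {d1} {V : measurableType d1} {n} (X : T -> n.-tuple V)
    (E : set T) : measurable_fun setT X -> measurable E ->
  (forall B : 'I_n -> set V, (forall i, measurable (B i)) ->
    P ([set t | forall i, B i (tnth (X t) i)] `&` E) =
    P [set t | forall i, B i (tnth (X t) i)] * P E) ->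
  forall A, measurable A -> P (X @^-1` A `&` E) = P (X @^-1` A) * P E.
Proof.
move=> mX mE XE A mA.
have PE0 : (0 <= fine (P E))%R by exact: fine_ge0.
have PEE : P E = (fine (P E))%:E by rewrite fineK// fin_num_measure.
pose m1 := image_measure (mrestr P mE) mX.
pose m2 := mscale (NngNum PE0) (image_measure P mX).
have m2E (B : set (n.-tuple V)) : m2 B = P (X @^-1` B) * P E.
  by rewrite [in RHS]PEE muleC.
apply: (etrans _ (m2E A)); apply: (@tuple_measure_unique _ _ _ _ m1 m2) => //.
  rewrite /m1 /image_measure /pushforward /mrestr/=.
  by rewrite (le_lt_trans (probability_le1 P _))// ?ltry// preimage_setT setTI.
by move=> B mB; apply: (etrans (XE B mB)); apply/esym; exact: m2E.
Qed.

Context d1 d2 {V1 : measurableType d1} {V2 : measurableType d2}.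
Variables (X : T -> V1) (Y : T -> V2).
Hypotheses (mX : measurable_fun setT X) (mY : measurable_fun setT Y).
Hypothesis XY : independent_pair P X Y.

Lemma independent_pairE C : measurable C ->
  P ((fun t => (X t, Y t)) @^-1` C) =
  (image_measure P mX \x image_measure P mY) C.
Proof.
move=> mC.
have mXY : measurable_fun setT (fun t => (X t, Y t)) by exact: measurable_fun_pair.
apply/esym/(@product_measure_unique _ _ _ _ _ _ _ (image_measure P mXY)) => //.
Qed.

(** Conditioning on [X]: the joint law is a product measure, computed section by section. This turns
    a bound with [X] frozen into one for the pair. *)
Lemma independent_pair_prob C : measurable C ->
  P [set t | C (X t, Y t)] = \int[P]_t P [set u | C (X t, Y u)].
Proof.
move=> mC; apply: (etrans (independent_pairE mC)).
rewrite /product_measure1 ge0_integral_image_measure//; last first.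
  exact: measurable_fun_xsection.
apply: eq_integral => t _ /=; rewrite /image_measure /pushforward.
congr (P _); apply/seteqP; split => u /=; rewrite /xsection/= inE//.
Qed.

Lemma independent_pair_integralM (f : V1 -> \bar R) (g : V2 -> \bar R) :
  measurable_fun setT f -> measurable_fun setT g ->
  (forall x, 0 <= f x) -> (forall y, 0 <= g y) ->
  \int[P]_t (f (X t) * g (Y t)) = \int[P]_t f (X t) * \int[P]_t g (Y t).
Proof.
move=> mf mg f0 g0.
have mXY : measurable_fun setT (fun t => (X t, Y t)) by exact: measurable_fun_pair.
pose F (z : V1 * V2) := f z.1 * g z.2.
have mF : measurable_fun setT F.
  by apply: emeasurable_funM; exact: measurableT_comp.
have F0 z : 0 <= F z by rewrite mule_ge0.
transitivity (\int[image_measure P mXY]_z F z).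
  by rewrite ge0_integral_image_measure.
transitivity (\int[image_measure P mX \x image_measure P mY]_z F z).
  by apply: eq_measure_integral => C mC _; exact: independent_pairE.
apply: (etrans (fubini_tonelli1 _ mF F0)).
have gE x : \int[image_measure P mY]_y F (x, y) = f x * \int[P]_t g (Y t).
  by rewrite /F/= ge0_integralZl// ge0_integral_image_measure.
under eq_integral do rewrite /fubini_F gE.
rewrite ge0_integralZr//; first by rewrite ge0_integral_image_measure.
by apply: integral_ge0.
Qed.

End independence.

(** * Independent standard normal variables *)

Section iid_normal.
Context {R : realType} {d : measure_display} {T : measurableType d}.
Variable P : probability T R.
Notation mR := (measurableTypeR R).
Notation gamma := (normal_prob (0 : R) 1).
Local Open Scope ereal_scope.

(** One product formula over all indices is enough: subfamilies are reached by taking [B i = setT]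
    elsewhere. *)
Definition iid_normal n (Z : 'I_n -> T -> mR) : Prop :=
  (forall i, measurable_fun setT (Z i)) /\
  forall B : 'I_n -> set mR, (forall i, measurable (B i)) ->
    P [set t | forall i, B i (Z i t)] = \prod_(i < n) gamma (B i).

Context {n : nat}.
Implicit Types (Z : 'I_n -> T -> mR) (i j : 'I_n).

Lemma iid_normal_law Z i A : iid_normal Z -> measurable A ->
  P (Z i @^-1` A) = gamma A.
Proof.
move=> [mZ ZB] mA; pose B k : set mR := if k == i then A else setT.
have mB k : measurable (B k) by rewrite /B; case: ifP.
have -> : Z i @^-1` A = [set t | forall k, B k (Z k t)].
  apply/seteqP; split => t /=; last by move=> /(_ i); rewrite /B eqxx.
  by move=> At k; rewrite /B; case: eqP => // ->.
rewrite ZB// (bigD1 i)//= {1}/B eqxx big1 ?mule1// => k /negbTE ki.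
by rewrite /B ki probability_setT.
Qed.

Lemma measurable_event Z B (J : pred 'I_n) : (forall i, measurable_fun setT (Z i)) ->
  (forall i, measurable (B i)) ->
  measurable [set t | forall i, J i -> B i (Z i t)].
Proof.
move=> mZ mB.
have -> : [set t | forall i, J i -> B i (Z i t)] =
    \bigcap_(i in [set` J]) (setT `&` Z i @^-1` B i).
  by apply/seteqP; split => x /= H i Ji; [split => //; exact: H|have [] := H i Ji].
apply: fin_bigcap_measurable => // i _; exact: mZ.
Qed.

(** A Givens rotation, that is [rotation c s] in the plane of the coordinates [i] and [j]. *)
Definition givens (c s : R) i j (x : 'I_n -> R) : 'I_n -> R :=
  fun k => if k == i then (c * x i + s * x j)%R
    else if k == j then (- s * x i + c * x j)%R else x k.

(** On an event [E] about the other coordinates, the law of [(Z i, Z j)] is [P E] times the planar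
    Gaussian measure, which the rotation preserves. *)
Lemma iid_normal_givens (c s : R) i j Z : i != j -> s != 0%R ->
  (c ^+ 2 + s ^+ 2 = 1)%R -> iid_normal Z ->
  iid_normal (fun k t => givens c s i j (Z ^~ t) k).
Proof.
move=> ij s0 cs1 [mZ ZB]; split => [k|B mB].
  rewrite /givens; case: (k == i); last case: (k == j) => //.
    by apply: measurable_funD; apply: measurable_funM => //; exact: mZ.
  by apply: measurable_funD; apply: measurable_funM => //; exact: mZ.
have ji : j != i by rewrite eq_sym.
pose J : pred 'I_n := [pred k | (k != i) && (k != j)].
pose E := [set t | forall k, J k -> B k (Z k t)].
have mE : measurable E by exact: measurable_event.
have PJ A1 A2 : measurable A1 -> measurable A2 ->
    P ([set t | A1 (Z i t) /\ A2 (Z j t)] `&` E) =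
    gamma A1 * (gamma A2 * \prod_(k | J k) gamma (B k)).
  move=> mA1 mA2.
  pose C k := if k == i then A1 else if k == j then A2 else B k.
  have mC k : measurable (C k) by rewrite /C; case: ifP => // _; case: ifP.
  have -> : [set t | A1 (Z i t) /\ A2 (Z j t)] `&` E =
      [set t | forall k, C k (Z k t)].
    apply/seteqP; split => t /=.
      move=> [[A1t A2t] Et] k; rewrite /C; case: eqP => [->//|/eqP ki].
      by case: eqP => [->//|/eqP kj]; apply: Et; rewrite /J/= ki kj.
    move=> H; split; last first.
      move=> k /andP[/negbTE ki /negbTE kj].
      by have := H k; rewrite /C ki kj.
    by split; [have := H i; rewrite /C eqxx|have := H j; rewrite /C eqxx (negbTE ji)].
  rewrite (ZB _ mC) (bigD1 i)//= (bigD1 j)//= /C !eqxx (negbTE ji).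
  by congr (_ * (_ * _)); apply: eq_bigr => k /andP[/negbTE -> /negbTE ->].
have PE : P E = \prod_(k | J k) gamma (B k).
  have := PJ setT setT measurableT measurableT; rewrite !probability_setT !mul1e => <-.
  by congr (P _); apply/seteqP; split => t //= -[].
have PE0 : (0 <= fine (P E))%R by exact: fine_ge0.
have PEE : P E = (fine (P E))%:E by rewrite fineK// fin_num_measure.
have mZij : measurable_fun setT (fun t => (Z i t, Z j t)) by exact: measurable_fun_pair.
pose m1 := image_measure (mrestr P mE) mZij.
pose m2 := mscale (NngNum PE0) (gamma \x gamma).
(* The factor [P E] is absorbed into the first marginal, so that [m1] and [m2] can both be
   identified with one product measure. *)
pose m0 := mscale (NngNum PE0) gamma.
have m12 C : measurable C -> m1 C = m2 C.
  move=> mC; transitivity ((m0 \x gamma) C).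
    apply/esym/(@product_measure_unique _ _ _ _ _ m0 gamma m1) => // A1 A2 mA1 mA2.
    apply: (etrans (PJ _ _ mA1 mA2)); rewrite -PE.
    rewrite muleA muleC muleA; congr (_ * _).
    by rewrite [in LHS]PEE.
  apply: (@product_measure_unique _ _ _ _ _ m0 gamma m2) => // A1 A2 mA1 mA2.
  transitivity ((fine (P E))%:E * (gamma A1 * gamma A2)).
    by congr (_ * _); exact: product_measure1E.
  by rewrite muleA.
pose C := rotation c s @^-1` (B i `*` B j).
have mBij : measurable (B i `*` B j) by exact: measurableX.
have mC : measurable C by rewrite -[X in measurable X]setTI; exact: measurable_rotation.
transitivity (m1 C).
  rewrite /m1 /image_measure /pushforward /mrestr/=; congr (P _).
  apply/seteqP; split => t /=.
    move=> H; split.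
      rewrite /C/rotation/=; split.
        by have := H i; rewrite /givens eqxx.
      by have := H j; rewrite /givens eqxx (negbTE ji).
    move=> k /andP[/negbTE ki /negbTE kj].
    by have := H k; rewrite /givens ki kj.
  rewrite /C/rotation/= => -[[Bi Bj] Et] k.
  rewrite /givens; case: eqP => [->//|/eqP ki].
  by case: eqP => [->//|/eqP kj]; apply: Et; rewrite /J/= ki kj.
rewrite m12// /m2 /mscale/=.
transitivity ((fine (P E))%:E * (gamma (B i) * gamma (B j))).
  congr (_ * _); apply: (etrans (normal_prob_prod_rot s0 cs1 mBij)).
  exact: product_measure1E.
rewrite -PEE PE [RHS](bigD1 i)//= [X in _ = _ * X](bigD1 j)//=.
by rewrite muleC muleA.
Qed.

(* The [i]-th coordinate is overwritten by [0] instead of being dropped, which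
   keeps the index type ['I_n]. *)
Definition others i Z (t : T) : n.-tuple mR :=
  [tuple (if k == i then 0%R : R else Z k t) | k < n].

Lemma measurable_others i Z : (forall k, measurable_fun setT (Z k)) ->
  measurable_fun setT (others i Z).
Proof.
move=> mZ; apply/measurable_fun_tnthP => k.
rewrite (_ : _ \o _ = if k == i then cst 0%R else Z k); first by case: ifP.
by apply/funext => t /=; rewrite tnth_mktuple; case: ifP.
Qed.

Lemma others_independent i Z : iid_normal Z ->
  independent_pair P (others i Z) (Z i).
Proof.
move=> iidZ; have [mZ ZB] := iidZ; move=> A C mA mC.
have mE : measurable (Z i @^-1` C) by rewrite -[X in measurable X]setTI; exact: mZ.
apply: tuple_indep_event => //; first exact: measurable_others.
(* Coordinate [i] of [others] is the constant 0: either [B i] contains 0 and imposes nothing, or the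
   box event is empty. *)
move=> B mB; have [Bi0|Bi0] := pselect (B i 0%R); last first.
  have -> : [set t | forall k, B k (tnth (others i Z t) k)] = set0.
    by apply/seteqP; split => t //= /(_ i); rewrite tnth_mktuple eqxx.
  by rewrite set0I measure0 mul0e.
pose D (F : set mR) k := if k == i then F else B k.
have mD F : measurable F -> forall k, measurable (D F k).
  by move=> mF k; rewrite /D; case: ifP.
have PD F : measurable F -> P [set t | forall k, D F k (Z k t)] =
    gamma F * \prod_(k < n | k != i) gamma (B k).
  move=> mF; rewrite (ZB _ (mD _ mF)) (bigD1 i)//= {1}/D eqxx; congr (_ * _).
  by apply: eq_bigr => k /negbTE ki; rewrite /D ki.
have -> : [set t | forall k, B k (tnth (others i Z t) k)] =
    [set t | forall k, D setT k (Z k t)].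
  apply/seteqP; split => t /= H k; have := H k; rewrite tnth_mktuple /D;
  by case: eqP => // ->.
have -> : [set t | forall k, D setT k (Z k t)] `&` Z i @^-1` C =
    [set t | forall k, D C k (Z k t)].
  apply/seteqP; split => t /=.
    by move=> [H Ct] k; have := H k; rewrite /D; case: eqP => // ->.
  move=> H; split; last by have := H i; rewrite /D eqxx.
  by move=> k; have := H k; rewrite /D; case: eqP.
rewrite !PD// probability_setT mul1e muleC; congr (_ * _).
exact/esym/iid_normal_law.
Qed.

(** The Laplace transform at [(b - 1) / 2] of a chi-square variable with [size s] degrees of
    freedom. By induction: the sum over the tail of [s] factors through [others], hence is
    independent of the head. *)
Lemma iid_normal_mgf (b : R) Z (s : seq 'I_n) : (0 < b)%R -> iid_normal Z ->
  uniq s ->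
  \int[P]_t (expR (- ((b - 1) * (\sum_(k <- s) Z k t ^+ 2) / 2)))%:E =
  ((Num.sqrt b)^-1 ^+ size s)%:E.
Proof.
move=> b0 iidZ; have [mZ _] := iidZ.
have mexp d' (U : measurableType d') (f : U -> R) : measurable_fun setT f ->
    measurable_fun setT (fun x => (expR (- ((b - 1) * f x / 2)))%:E).
  move=> mf; apply/measurable_EFinP; apply: measurableT_comp => //.
  apply: measurableT_comp => //; apply: measurable_funM => //.
  exact: measurable_funM.
elim: s => [_|i s IH /= /andP[is_ us]].
  under eq_integral do rewrite big_nil mulr0 mul0r oppr0 expR0.
  by rewrite expr0 integral_cst// mul1e; exact: probability_setT.
pose f (x : n.-tuple mR) := (expR (- ((b - 1) * (\sum_(k <- s) tnth x k ^+ 2) / 2)))%:E.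
pose g (x : mR) := (expR (- ((b - 1) * x ^+ 2 / 2)))%:E.
have SE t : (\sum_(k <- s) tnth (others i Z t) k ^+ 2 = \sum_(k <- s) Z k t ^+ 2)%R.
  apply: eq_big_seq => k ks; rewrite tnth_mktuple.
  by case: eqP ks is_ => // -> ->.
have fE t : f (others i Z t) = (expR (- ((b - 1) * (\sum_(k <- s) Z k t ^+ 2) / 2)))%:E.
  by rewrite /f SE.
transitivity (\int[P]_t (f (others i Z t) * g (Z i t))).
  apply: eq_integral => t _; rewrite fE -EFinM -expRD big_cons.
  by congr (expR _)%:E; ring.
rewrite independent_pair_integralM//; last 6 first.
- exact: measurable_others.
- exact: others_independent.
- apply: mexp; apply: measurable_sum => k; apply: measurable_funX.
  exact: measurable_tnth.
- by apply: mexp; exact: measurable_funX.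
- by move=> x; rewrite lee_fin expR_ge0.
- by move=> x; rewrite lee_fin expR_ge0.
under eq_integral do rewrite fE.
rewrite IH//.
have -> : \int[P]_t g (Z i t) = ((Num.sqrt b)^-1)%:E.
  rewrite -(ge0_integral_image_measure P (mZ i)); last 2 first.
  - by apply: mexp; exact: measurable_funX.
  - by move=> x; rewrite lee_fin expR_ge0.
  rewrite -integral_normal_expR//; apply: eq_measure_integral => A mA _.
  exact: iid_normal_law.
by rewrite -EFinM -exprSr.
Qed.

End iid_normal.

(** * Tail of a squared normal against an independent chi-square *)

Section ratio_tail.
Context {R : realType}.

Lemma measurable_ltr_set d (T : measurableType d) (f g : T -> R) :
  measurable_fun setT f -> measurable_fun setT g ->
  measurable [set x | f x < g x].
Proof.
move=> mf mg.
rewrite (_ : [set x | f x < g x] = setT `&` (g \- f) @^-1` `]0, +oo[%classic).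
  by apply: measurable_funB => //; exact: measurable_itv.
by rewrite setTI; apply/seteqP; split => x /=; rewrite in_itv/= andbT subr_gt0.
Qed.

Lemma measurable_ler_set d (T : measurableType d) (f g : T -> R) :
  measurable_fun setT f -> measurable_fun setT g ->
  measurable [set x | f x <= g x].
Proof.
move=> mf mg.
rewrite (_ : [set x | f x <= g x] = setT `&` (g \- f) @^-1` `[0, +oo[%classic).
  by apply: measurable_funB => //; exact: measurable_itv.
by rewrite setTI; apply/seteqP; split => x /=; rewrite in_itv/= andbT subr_ge0.
Qed.

(** The base of the geometric decay on the range of small [V]. From [exp(-1/4) >= 3/4] and
    [sqrt 3 >= 8/5], as [(4/3) / (8/5) = 5/6]. *)
Lemma expR4_sqrt3 : expR 4^-1 / Num.sqrt 3 <= 5 / 6 :> R.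
Proof.
have e43 : expR 4^-1 <= 4 / 3 :> R.
  rewrite -[leLHS]invrK -expRN -[leRHS]invrK invf_div lef_pV2 ?posrE ?expR_gt0//.
  by apply: le_trans (expR_ge1Dx _); lra.
have s3 : 8 / 5 <= Num.sqrt 3 :> R.
  by rewrite -(@ger0_norm _ (8 / 5))// -sqrtr_sqr ler_sqrt//; lra.
have s30 : 0 < Num.sqrt 3 :> R by rewrite sqrtr_gt0.
by rewrite ler_pdivrMr//; lra.
Qed.

(** Bernoulli's inequality gives [(6/5)^k >= 1 + k/5 >= sqrt k / 5]. The geometric decay is weakened
    to the rate of the main term. *)
Lemma exprn_le_sqrtV (k : nat) : (0 < k)%N ->
  (5 / 6) ^+ k <= 5 / Num.sqrt k%:R :> R.
Proof.
move=> k0.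
have bern : 1 + k%:R / 5 <= (6 / 5) ^+ k :> R.
  elim: k {k0} => [|k IH]; first by rewrite expr0; lra.
  have : 0 <= k%:R :> R by [].
  by rewrite exprS -natr1; nra.
have k1 : 1 <= k%:R :> R by rewrite ler1n.
have s0 : 0 < Num.sqrt k%:R :> R by rewrite sqrtr_gt0 ltr0n.
have sk : Num.sqrt k%:R <= k%:R :> R.
  have := sqr_sqrtr (ler0n R k); nra.
rewrite (_ : 5 / 6 = (6 / 5)^-1); last by field.
rewrite exprVn -[leRHS]invrK lef_pV2 ?posrE ?exprn_gt0 ?invr_gt0 ?divr_gt0//.
by apply: le_trans bern; rewrite invf_div; nra.
Qed.

Context {d : measure_display} {T : measurableType d}.
Variable P : probability T R.
Notation mR := (measurableTypeR R).

(* With [b = 1 / (1 - rho^2)], the event says [Z_i^2 > (b - 1) V].  Given [V]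
   its probability is at most [exp(-(b-1)V/2) * min(2, 1 / sqrt((b-1)V))], and
   tilting by the exponential factor makes [b V] a chi-square variable with
   [size s] degrees of freedom; the second term below controls the part where
   [b V] is smaller than a quarter of its typical size. *)
Lemma iid_normal_ratio_tail (n : nat) (Z : 'I_n -> T -> mR) (i : 'I_n)
    (s : seq 'I_n) (rho : R) :
  iid_normal P Z -> uniq s -> i \notin s -> (0 < size s)%N ->
  0 < rho -> rho < 1 ->
  (P [set t | (rho ^+ 2 * (\sum_(k <- s) Z k t ^+ 2) < (1 - rho ^+ 2) * Z i t ^+ 2)%R]
   <= (Num.sqrt (1 - rho ^+ 2) ^+ size s *
       (12 / (rho * Num.sqrt (size s)%:R)))%:E)%E.
Proof.
move=> iidZ us is_ s0 rho0 rho1; have [mZ _] := iidZ.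
set k := size s; set q := Num.sqrt (1 - rho ^+ 2).
have q20 : 0 < 1 - rho ^+ 2 by nra.
have q0 : 0 < q by rewrite sqrtr_gt0.
have q2E : q ^+ 2 = 1 - rho ^+ 2 by rewrite sqr_sqrtr// ltW.
have sk0 : 0 < Num.sqrt k%:R :> R by rewrite sqrtr_gt0 ltr0n.
have sk2 : Num.sqrt k%:R ^+ 2 = k%:R :> R by rewrite sqr_sqrtr.
pose b : R := (1 - rho ^+ 2)^-1.
have b0 : 0 < b by rewrite invr_gt0.
have bq : b * (1 - rho ^+ 2) = 1 by rewrite mulVf ?gt_eqF.
have b1 : 0 < b - 1 by rewrite subr_gt0 /b invf_gt1//; nra.
have sb : (Num.sqrt b)^-1 = q by rewrite sqrtrV ?ltW// invrK.
have s3b : (Num.sqrt (3 * b))^-1 = q / Num.sqrt 3.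
  by rewrite sqrtrM// invfM sb mulrC.
pose V t : R := \sum_(k <- s) Z k t ^+ 2.
have V0 t : 0 <= V t by apply: sumr_ge0 => j _; exact: sqr_ge0.
(* A bound for [1 / w] once [v >= k / (4 b)]: then [w^2 = (b - 1) v >= rho^2 k / 4], because
   [(b - 1) / b = rho^2]. *)
pose eps := 2 / (rho * Num.sqrt k%:R).
have eps0 : 0 < eps by rewrite divr_gt0// mulr_gt0.
pose S (x : n.-tuple mR) : R := \sum_(k <- s) tnth x k ^+ 2.
pose C : set (n.-tuple mR * mR) :=
  [set z | rho ^+ 2 * S z.1 < (1 - rho ^+ 2) * z.2 ^+ 2].
have mS : measurable_fun setT S.
  by apply: measurable_sum => j; apply: measurable_funX; exact: measurable_tnth.
have mC : measurable C.
  rewrite -[C]setTI.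
  have m1 : measurable_fun setT (fun z : n.-tuple mR * mR => rho ^+ 2 * S z.1).
    by apply: measurable_funM => //; exact: measurableT_comp.
  have m2 : measurable_fun setT (fun z : n.-tuple mR * mR => (1 - rho ^+ 2) * z.2 ^+ 2 : R).
    by apply: measurable_funM => //; exact: measurable_funX.
  rewrite setTI; exact: measurable_ltr_set.
have SE t : S (others i Z t) = V t.
  apply: eq_big_seq => j js; rewrite tnth_mktuple.
  by case: eqP js is_ => // -> ->.
(* The bounds for large and small [v] are added, so no case split survives the integration. The
   second term is [2 exp(-(b-1)v/2)] times the Chernoff factor [exp(k/4 - b v)], which is at least 1
   when [b v <= k/4]. *)
pose h (v : R) := eps * expR (- ((b - 1) * v / 2)) +
  2 * expR (k%:R / 4) * expR (- ((3 * b - 1) * v / 2)).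
have mz (v : R) : measurable [set z : mR | (rho ^+ 2 * v < (1 - rho ^+ 2) * z ^+ 2)%R].
  apply: (@measurable_ltr_set _ mR) => //.
  by apply: measurable_funM => //; exact: measurable_funX.
have mzw (w : R) : measurable [set z : mR | (w <= `|z|)%R].
  by apply: (@measurable_ler_set _ mR) => //; exact: normr_measurable.
have tail v : 0 <= v ->
    (normal_prob 0 1 [set z : mR | (rho ^+ 2 * v < (1 - rho ^+ 2) * z ^+ 2)%R] <= (h v)%:E)%E.
  move=> v0; pose w := Num.sqrt ((b - 1) * v).
  have w2 : w ^+ 2 = (b - 1) * v by rewrite sqr_sqrtr// mulr_ge0// ltW.
  have w0 : 0 <= w by exact: sqrtr_ge0.
  apply: (@le_trans _ _ (normal_prob 0 1 [set z : mR | (w <= `|z|)%R])).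
    apply: le_measure; rewrite ?inE// => z /= zv.
    rewrite -sqrtr_sqr ler_sqrt ?sqr_ge0//.
    rewrite -(ler_pM2l q20); apply: ltW; apply: le_lt_trans zv.
    by rewrite mulrA mulrBr mulr1 (mulrC _ b) bq; lra.
  have e2 : expR (- ((b - 1) * v / 2)) = expR (- (w ^+ 2 / 2)) by rewrite w2.
  have [vk|vk] := leP (k%:R / (4 * b)) v.
    have wk : rho * Num.sqrt k%:R / 2 <= w.
      rewrite -(@ler_pXn2r _ 2)// ?nnegrE// ?divr_ge0 ?mulr_ge0 ?(ltW rho0) ?(ltW sk0)//.
      rewrite w2 !exprMn sk2 exprVn.
      apply: (@le_trans _ _ ((b - 1) * (k%:R / (4 * b)))); last by rewrite ler_wpM2l// ltW.
      rewrite le_eqVlt; apply/orP; left; apply/eqP.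
      have -> : rho ^+ 2 = (b - 1) / b by rewrite mulrBl divff ?gt_eqF// mul1r /b invrK; ring.
      by field; rewrite gt_eqF.
    have wp : 0 < w by apply: lt_le_trans wk; rewrite divr_gt0// mulr_gt0.
    apply: (le_trans (normal_prob_tail wp)); rewrite lee_fin /h e2.
    apply: (@le_trans _ _ (eps * expR (- (w ^+ 2 / 2)))); last first.
      by rewrite lerDl !mulr_ge0 ?expR_ge0.
    rewrite mulrC ler_wpM2r ?expR_ge0// /eps -invf_div lef_pV2 ?posrE ?divr_gt0 ?mulr_gt0//.
  apply: (le_trans (normal_prob_tail2 w0)); rewrite lee_fin /h -e2.
  apply: (@le_trans _ _ (2 * expR (k%:R / 4) * expR (- ((3 * b - 1) * v / 2)))); last first.
    by rewrite lerDr mulr_ge0 ?expR_ge0// ltW.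
  rewrite -[leRHS]mulrA ler_pM2l// -expRD ler_expR.
  have : b * v <= k%:R / 4.
    rewrite ltW// -(@ltr_pM2l _ (b^-1)) ?invr_gt0// mulKf ?gt_eqF//.
    by rewrite (_ : b^-1 * (k%:R / 4) = k%:R / (4 * b))//; field; rewrite gt_eqF.
  by lra.
have EC : [set t | rho ^+ 2 * V t < (1 - rho ^+ 2) * Z i t ^+ 2] =
    [set t | C (others i Z t, Z i t)].
  by apply/seteqP; split => t /=; rewrite /C/= SE.
have mZi : measurable_fun setT (Z i) by exact: mZ.
have mO := measurable_others i mZ.
rewrite [X in (P X <= _)%E]EC.
have mV : measurable_fun setT V.
  by apply: measurable_sum => j; apply: measurable_funX; exact: mZ.
have mexp (c : R) : measurable_fun setT (fun t => expR (- (c * V t / 2))).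
  apply: measurableT_comp => //; apply: measurableT_comp => //.
  by apply: measurable_funM => //; exact: measurable_funM.
have mh : measurable_fun setT (fun t => (h (V t))%:E).
  by apply/measurable_EFinP; apply: measurable_funD; apply: measurable_funM.
have PC t : P [set u | C (others i Z t, Z i u)] =
    normal_prob 0 1 [set z : mR | (rho ^+ 2 * V t < (1 - rho ^+ 2) * z ^+ 2)%R].
  rewrite -(iid_normal_law i iidZ (mz (V t))); congr (P _).
  by apply/seteqP; split => u; rewrite /C/= SE.
have mPC : measurable_fun setT (fun t => P [set u | C (others i Z t, Z i u)]).
  have -> : (fun t => P [set u | C (others i Z t, Z i u)]) =
      (image_measure P mZi \o xsection C) \o others i Z.
    apply/funext => t /=; rewrite /image_measure /pushforward; congr (P _).
    by apply/seteqP; split => u /=; rewrite /xsection/= inE.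
  by apply: (measurableT_comp _ mO); exact: measurable_fun_xsection.
apply: (@le_trans _ _ (\int[P]_t (h (V t))%:E)%E).
  rewrite (independent_pair_prob mO mZi (others_independent i iidZ) mC).
  by apply: ge0_le_integral => // t _; rewrite PC; exact: tail.
have intE (c : R) : 0 < c -> (\int[P]_t (expR (- ((c - 1) * V t / 2)))%:E =
    ((Num.sqrt c)^-1 ^+ k)%:E)%E.
  by move=> c0; exact: iid_normal_mgf.
under eq_integral do rewrite /h EFinD (EFinM eps) (EFinM (2 * expR _)).
rewrite ge0_integralD//=; last 3 first.
- by move=> t _; rewrite -EFinM lee_fin mulr_ge0 ?expR_ge0// ltW.
- by apply: measurable_funeM; exact/measurable_EFinP.
- by apply: measurable_funeM; exact/measurable_EFinP.
rewrite ge0_integralZl//=; last 2 first.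
- exact/measurable_EFinP.
- by rewrite lee_fin ltW.
rewrite ge0_integralZl//=; last 1 first.
- exact/measurable_EFinP.
(* At [c = b] the integral is [q^k]; at [c = 3 b] it is [(q / sqrt 3)^k], and the gain [3^(-k/2)]
   beats [exp(k/4)]. *)
rewrite !intE//; last by rewrite mulr_gt0.
rewrite -!EFinM -EFinD lee_fin sb s3b.
have -> : 2 * expR (k%:R / 4) * (q / Num.sqrt 3) ^+ k =
    q ^+ k * (2 * (expR 4^-1 / Num.sqrt 3) ^+ k).
  by rewrite !expr_div_n -expRM_natl; ring.
rewrite (mulrC eps) -mulrDr ler_pM2l ?exprn_gt0//.
have qk : (expR 4^-1 / Num.sqrt 3) ^+ k <= 5 / Num.sqrt k%:R :> R.
  apply: le_trans (exprn_le_sqrtV s0); apply: lerXn2r; rewrite ?nnegrE ?divr_ge0 ?expR_ge0//.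
  exact: expR4_sqrt3.
(* As [rho < 1], both terms fit over [rho sqrt k], and the constant is [2 + 2 * 5 = 12]. *)
have : 5 / Num.sqrt k%:R <= 5 / (rho * Num.sqrt k%:R).
  by rewrite ler_pM2l// lef_pV2 ?posrE ?mulr_gt0// ler_piMl ?(ltW sk0) ?(ltW rho1).
by rewrite /eps; lra.
Qed.

End ratio_tail.

(** * The sample correlation *)

Section givens_rotations.
Context {R : realType} {d : measure_display} {T : measurableType d}.
Variables (P : probability T R) (n : nat).
Implicit Types (x y v : 'I_n -> R) (i j k : 'I_n) (g : ('I_n -> R) -> 'I_n -> R).

Definition dot x y : R := \sum_k x k * y k.

(** Both clauses pass to composites, so products of Givens rotations are handled without
    matrices. *)
Definition gaussian_isometry g : Prop :=
  (forall x y, dot (g x) (g y) = dot x y) /\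
  (forall Z : 'I_n -> T -> measurableTypeR R, iid_normal P Z ->
     iid_normal P (fun k t => g (Z ^~ t) k)).

Lemma dot_givens c s i j x y : i != j -> c ^+ 2 + s ^+ 2 = 1 ->
  dot (givens c s i j x) (givens c s i j y) = dot x y.
Proof.
move=> ij cs1; have ji : j != i by rewrite eq_sym.
rewrite /dot (bigD1 i)//= (bigD1 j)//= [RHS](bigD1 i)//= [X in _ = _ + X](bigD1 j)//=.
rewrite /givens !eqxx (negbTE ji).
rewrite (eq_bigr (fun k => x k * y k)); last first.
  by move=> k /andP[/negbTE -> /negbTE ->].
rewrite !addrA; congr (_ + _).
transitivity ((c ^+ 2 + s ^+ 2) * (x i * y i + x j * y j)); first ring.
by rewrite cs1 mul1r.
Qed.

(** Elimination by rotations: for each [j] in [r], a rotation in the plane of [i] and [j] moves the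
    weight of coordinate [j] into coordinate [i] and leaves the coordinates already cleared
    alone. *)
Lemma rotate_to_axis v i (r : seq 'I_n) : i \notin r ->
  exists g, [/\ gaussian_isometry g, (forall k, k \in r -> g v k = 0)
    & (forall x k, k != i -> k \notin r -> g x k = x k)].
Proof.
elim: r => [_|j r IH]; first by exists id; split.
rewrite inE negb_or => /andP[ij ir].
have [g [[gdot giid] gv gfix]] := IH ir.
(* A coordinate already equal to 0 is skipped: the rotation would have sine 0, which
   [iid_normal_givens] excludes, and [h] could vanish. *)
have [gj0|gj0] := eqVneq (g v j) 0.
  exists g; split => //.
    by move=> k; rewrite inE => /orP[/eqP->//|]; exact: gv.
  by move=> x k ki; rewrite inE negb_or => /andP[_]; exact: gfix.
pose h := Num.sqrt (g v i ^+ 2 + g v j ^+ 2).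
have h2 : h ^+ 2 = g v i ^+ 2 + g v j ^+ 2.
  by rewrite sqr_sqrtr// addr_ge0 ?sqr_ge0.
have h0 : h != 0.
  have : 0 < g v j ^+ 2 by rewrite exprn_even_gt0.
  have := sqr_ge0 (g v i); move=> a b; apply/negP => /eqP h0.
  by move: h2; rewrite h0; nra.
have cs1 : (g v i / h) ^+ 2 + (g v j / h) ^+ 2 = 1.
  by rewrite !expr_div_n -mulrDl -h2 divff// expf_neq0.
have s0 : g v j / h != 0 by rewrite mulf_neq0// invr_neq0.
exists (fun x => givens (g v i / h) (g v j / h) i j (g x)); split.
- split; first by move=> x y; rewrite dot_givens.
  by move=> Z iidZ; exact: iid_normal_givens (giid _ iidZ).
- move=> k; rewrite inE /givens.
  have [->|kj] := eqVneq k j; first by rewrite eq_sym (negbTE ij) => _; ring.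
  move=> /= kr; case: eqP => [ki|_]; last exact: gv.
  by rewrite -ki kr in ir.
- move=> x k ki; rewrite inE negb_or => /andP[kj kr].
  by rewrite /givens (negbTE ki) (negbTE kj) gfix.
Qed.

End givens_rotations.

Section sample_correlation_tail.
Context {R : realType} {n : nat}.
Implicit Types (x y : 'I_n -> R).

Lemma sum_centered x : (0 < n)%N -> \sum_i (x i - sample_mean x) = 0.
Proof.
move=> n0; rewrite sumrB sumr_const card_ord /sample_mean -[X in _ - X]mulr_natr.
by rewrite divfK ?subrr// pnatr_eq0 -lt0n.
Qed.

Lemma sum_mul_centered x y : (0 < n)%N ->
  \sum_i (x i - sample_mean x) * (y i - sample_mean y) =
  \sum_i (x i - sample_mean x) * y i.
Proof.
move=> n0; under eq_bigr do rewrite mulrBr.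
by rewrite sumrB -mulr_suml sum_centered// mul0r subr0.
Qed.

Lemma sum_sqr_centered x : (0 < n)%N ->
  \sum_i (x i - sample_mean x) ^+ 2 = \sum_i x i ^+ 2 - (\sum_i x i) ^+ 2 / n%:R.
Proof.
move=> n0; under eq_bigr do rewrite expr2.
rewrite sum_mul_centered//; under eq_bigr do rewrite mulrBl.
rewrite sumrB -mulr_sumr /sample_mean; congr (_ - _).
by ring.
Qed.

Lemma sample_corr_affine x y (m s : R) : (0 < n)%N -> 0 < s ->
  sample_corr x (fun i => (y i - m) / s) = sample_corr x y.
Proof.
move=> n0 s0.
have n1 : n%:R != 0 :> R by rewrite pnatr_eq0 -lt0n.
have meanE : sample_mean (fun i => (y i - m) / s) = (sample_mean y - m) / s.
  rewrite /sample_mean -mulr_suml sumrB sumr_const card_ord -[X in _ - X]mulr_natr.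
  by field; rewrite n1 gt_eqF.
have cE i : (y i - m) / s - (sample_mean y - m) / s = (y i - sample_mean y) / s.
  by rewrite -mulrBl; congr (_ / _); ring.
rewrite /sample_corr /corr_denominator meanE.
under eq_bigr do rewrite cE mulrA.
under [X in _ / (_ * Num.sqrt X)]eq_bigr do rewrite cE expr_div_n.
rewrite -!mulr_suml sqrtrM ?sumr_ge0// => [|i _]; last exact: sqr_ge0.
rewrite sqrtrV ?sqr_ge0// sqrtr_sqr gtr0_norm// !invfM invrK.
rewrite -!mulrA; congr (_ * _); rewrite mulrCA; congr (_ * _).
by rewrite mulrCA mulVf ?mulr1// gt_eqF.
Qed.

(** Division by 0 returns 0, so a correlation exceeding [rho >= 0] forces a positive denominator,
    which can then be cleared. *)
Lemma sample_corr_gtE x y (rho : R) : 0 <= rho ->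
  (rho < `|sample_corr x y|) =
  (0 < corr_denominator x y) &&
  (rho * corr_denominator x y <
   `|\sum_i (x i - sample_mean x) * (y i - sample_mean y)|).
Proof.
move=> rho0; have D0 : 0 <= corr_denominator x y by rewrite mulr_ge0// sqrtr_ge0.
rewrite /sample_corr normrM normfV (ger0_norm D0).
have [D|D|D] := ltrgt0P (corr_denominator x y); last 2 first.
- by move: D0; rewrite leNgt D.
- by rewrite D invr0 mulr0 ltNge rho0.
by rewrite ltr_pdivlMr.
Qed.

Context {d : measure_display} {T : measurableType d}.
Variable P : probability T R.

(** Take the vector of ones to axis [i0] and the centered column to axis [i1]: the numerator becomes
    a product of two single coordinates, and the [n - 2] coordinates left over form [s]. The map [g]
    depends on [x] alone, so it may be applied to a Gaussian [y]. *)
Lemma sample_corr_isometry x : (2 < n)%N ->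
  exists (g : ('I_n -> R) -> 'I_n -> R) (i : 'I_n) (s : seq 'I_n),
  [/\ gaussian_isometry P g, uniq s, i \notin s, size s = (n - 2)%N &
   forall y rho, 0 <= rho -> rho < `|sample_corr x y| ->
     rho ^+ 2 * (\sum_(k <- s) g y k ^+ 2) < (1 - rho ^+ 2) * g y i ^+ 2].
Proof.
move=> n3; have n0 : (0 < n)%N by exact: leq_trans n3.
have n1 : (1 < n)%N by exact: leq_trans n3.
have nR : 0 < n%:R :> R by rewrite ltr0n.
pose i0 := Ordinal n0; pose i1 := Ordinal n1.
have i10 : i1 != i0 by [].
pose xc i := x i - sample_mean x.
pose one (i : 'I_n) : R := 1.
have [g1 [[g1dot g1iid] g1one _]] : exists g, [/\ gaussian_isometry P g,
    (forall k, k \in enum (~: [set i0]) -> g one k = 0)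
    & (forall x k, k != i0 -> k \notin enum (~: [set i0]) -> g x k = x k)].
  by apply: rotate_to_axis; rewrite mem_enum !inE eqxx.
pose s := enum (~: [set i0; i1]).
have sE k : (k \in s) = (k != i0) && (k != i1).
  by rewrite mem_enum !inE negb_or.
(* The second rotation fixes coordinate [i0], so it does not undo the first. *)
have [g2 [[g2dot g2iid] g2u g2fix]] : exists g, [/\ gaussian_isometry P g,
    (forall k, k \in s -> g (g1 xc) k = 0)
    & (forall x k, k != i1 -> k \notin s -> g x k = x k)].
  by apply: rotate_to_axis; rewrite sE eqxx andbF.
have g2i0 v : g2 v i0 = v i0 by apply: g2fix; [rewrite eq_sym|rewrite sE eqxx].
have g1one0 k : k != i0 -> g1 one k = 0.
  by move=> ki; apply: g1one; rewrite mem_enum !inE.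
have dot_one v : dot one v = g1 one i0 * g1 v i0.
  rewrite -g1dot /dot (bigD1 i0)//= big1 ?addr0// => k /g1one0 ->.
  by rewrite mul0r.
have alpha2 : g1 one i0 ^+ 2 = n%:R.
  rewrite expr2 -dot_one /dot (eq_bigr (fun=> 1)); last by move=> k _; rewrite mulr1.
  by rewrite sumr_const card_ord.
have alpha0 : g1 one i0 != 0.
  by apply/negP => /eqP a0; move: alpha2; rewrite a0; nra.
have sum_one v : \sum_k v k = dot one v by apply: eq_bigr => k _; rewrite mul1r.
(* Centering is orthogonality to [one], which now lies along [i0]. *)
have u0 : g1 xc i0 = 0.
  have := dot_one xc; rewrite -sum_one sum_centered// => /esym/eqP.
  by rewrite mulf_eq0 (negbTE alpha0) => /eqP.
pose g v := g2 (g1 v).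
have gxc0 k : k != i1 -> g xc k = 0.
  move=> ki; have [->|ki0] := eqVneq k i0; first by rewrite /g g2i0.
  by apply: g2u; rewrite sE ki0.
have gdot v w : dot (g v) (g w) = dot v w by rewrite g2dot g1dot.
have dot_xc v : dot xc v = g xc i1 * g v i1.
  rewrite -gdot /dot (bigD1 i1)//= big1 ?addr0// => k /gxc0 ->.
  by rewrite mul0r.
exists g, i1, s; split.
- by split=> // Z iidZ; exact: g2iid (g1iid _ iidZ).
- exact: enum_uniq.
- by rewrite sE eqxx andbF.
- have := cardsC [set i0; i1]; rewrite cards2 eq_sym i10 card_ord -cardE => cs.
  by have := congr1 (subn^~ 2%N) cs; rewrite addKn.
move=> y rho rho0; rewrite sample_corr_gtE// => /andP[].
rewrite sum_mul_centered// -/(dot xc y) dot_xc /corr_denominator.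
have -> : \sum_i (x i - sample_mean x) ^+ 2 = g xc i1 ^+ 2.
  by rewrite [RHS]expr2 -dot_xc; apply: eq_bigr => k _; rewrite expr2.
(* Subtracting the mean removes exactly the squared coordinate along [i0], which is the square of
   the sum of [y] divided by [n]. *)
have -> : \sum_i (y i - sample_mean y) ^+ 2 =
    \sum_(k <- s) g y k ^+ 2 + g y i1 ^+ 2.
  rewrite sum_sqr_centered// (sum_one y) dot_one -(g2i0 (g1 y)) -/(g y).
  rewrite exprMn alpha2 mulrAC divff ?gt_eqF// mul1r.
  have -> : \sum_i y i ^+ 2 = dot (g y) (g y).
    by rewrite gdot; apply: eq_bigr => k _; rewrite expr2.
  have -> : \sum_(k <- s) g y k ^+ 2 =
      \sum_(k | (k != i0) && (k != i1)) g y k * g y k.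
    by rewrite big_enum/=; apply: eq_big => [k|k _]; rewrite ?inE ?negb_or ?expr2.
  by rewrite /dot (bigD1 i0)//= (bigD1 i1)//=; ring.
set S := \sum_(k <- s) _; set z := g y i1; set be := g xc i1.
have S0 : 0 <= S by apply: sumr_ge0 => k _; exact: sqr_ge0.
rewrite sqrtr_sqr => D0 H.
have be0 : 0 < `|be|.
  by rewrite lt_neqAle normr_ge0 andbT eq_sym; apply: contraTneq D0 => ->; rewrite mul0r ltxx.
have Sz0 : 0 <= S + z ^+ 2 by rewrite addr_ge0// sqr_ge0.
have : rho * Num.sqrt (S + z ^+ 2) < `|z|.
  by rewrite -(ltr_pM2l be0) -normrM mulrCA.
rewrite -(@ltr_pXn2r _ 2)// ?nnegrE ?mulr_ge0 ?sqrtr_ge0//.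
rewrite exprMn sqr_sqrtr// real_normK ?num_real//.
by lra.
Qed.

End sample_correlation_tail.

(** * One random column: conditioning on the covariate *)

Section correlation_tail.
Context {R : realType}.
Notation mR := (measurableTypeR R).

Definition corr_bound (n : nat) (rho : R) : R :=
  Num.sqrt (1 - rho ^+ 2) ^+ (n - 2) * (12 / (rho * Num.sqrt (n - 2)%:R)).

Lemma measurable_sample_corr_gt d (U : measurableType d) n (f g : 'I_n -> U -> R)
    (rho : R) : 0 <= rho ->
  (forall i, measurable_fun setT (f i)) -> (forall i, measurable_fun setT (g i)) ->
  measurable [set u | rho < `|sample_corr (f ^~ u) (g ^~ u)|].
Proof.
move=> rho0 mf mg.
have mmean (h : 'I_n -> U -> R) : (forall i, measurable_fun setT (h i)) ->
    measurable_fun setT (fun u => sample_mean (h ^~ u)).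
  by move=> mh; apply: measurable_funM => //; exact: measurable_sum.
have mc (h : 'I_n -> U -> R) i : (forall i, measurable_fun setT (h i)) ->
    measurable_fun setT (fun u => h i u - sample_mean (h ^~ u)).
  by move=> mh; apply: measurable_funB => //; exact: mmean.
have msq (h : 'I_n -> U -> R) : (forall i, measurable_fun setT (h i)) ->
    measurable_fun setT (fun u => Num.sqrt (\sum_i (h i u - sample_mean (h ^~ u)) ^+ 2)).
  move=> mh; apply: measurableT_comp.
    by apply: continuous_measurable_fun; exact: sqrt_continuous.
  by apply: measurable_sum => i; apply: measurable_funX; exact: mc.
have mD : measurable_fun setT (fun u => corr_denominator (f ^~ u) (g ^~ u)).
  by apply: measurable_funM; exact: msq.
rewrite (_ : [set u | _] =
    [set u | 0 < corr_denominator (f ^~ u) (g ^~ u)] `&`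
    [set u | rho * corr_denominator (f ^~ u) (g ^~ u) <
      `|\sum_i (f i u - sample_mean (f ^~ u)) * (g i u - sample_mean (g ^~ u))|]); last first.
  by apply/seteqP; split => u /=; rewrite sample_corr_gtE// => /andP.
apply: measurableI; apply: measurable_ltr_set => //.
  exact: measurable_funM.
apply: measurableT_comp; first exact: normr_measurable.
by apply: measurable_sum => i; apply: measurable_funM; exact: mc.
Qed.

Context {d : measure_display} {T : measurableType d}.
Variable P : probability T R.

Lemma corr_tail_fixed n (x : 'I_n -> R) (Z : 'I_n -> T -> mR) (rho : R) :
  (2 < n)%N -> 0 < rho -> rho < 1 -> iid_normal P Z ->
  (P [set t | (rho < `|sample_corr x (Z ^~ t)|)%R] <= (corr_bound n rho)%:E)%E.
Proof.
move=> n2 rho0 rho1 iidZ; have [mZ _] := iidZ.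
have [g [i [s [[_ giid] us is_ sz H]]]] := sample_corr_isometry P x n2.
have iidG := giid _ iidZ; have [mG _] := iidG.
rewrite /corr_bound -sz; apply: le_trans (iid_normal_ratio_tail iidG us is_ _ rho0 rho1).
  apply: le_measure; rewrite ?inE.
  - by apply: (measurable_sample_corr_gt (f := fun i => cst (x i))); [exact: ltW|by []|exact: mZ].
  - apply: measurable_ltr_set; apply: measurable_funM => //.
      by apply: measurable_sum => k; apply: measurable_funX; exact: mG.
    by apply: measurable_funX; exact: mG.
  - by move=> t /=; apply: H; exact: ltW.
by rewrite sz subn_gt0.
Qed.

(** Standardizing [Y] leaves the correlation unchanged; with [X] frozen, [corr_tail_fixed] gives a
    bound free of [X], which is then integrated. The law of the column stays arbitrary. *)
Lemma corr_tail n (X Y : 'I_n -> T -> mR) (m s rho : R) :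
  (2 < n)%N -> 0 < s -> 0 < rho -> rho < 1 ->
  (forall i, measurable_fun setT (X i)) -> (forall i, measurable_fun setT (Y i)) ->
  (forall A B : 'I_n -> set mR,
     (forall i, measurable (A i)) -> (forall i, measurable (B i)) ->
     P [set t | forall i, A i (X i t) /\ B i (Y i t)] =
     P [set t | forall i, A i (X i t)] * \prod_(i < n) normal_prob m s (B i))%E ->
  (P [set t | (rho < `|sample_corr (X ^~ t) (Y ^~ t)|)%R] <= (corr_bound n rho)%:E)%E.
Proof.
move=> n2 s0 rho0 rho1 mX mY XY.
pose Z i t : mR := (Y i t - m) / s.
have PY (B : 'I_n -> set mR) : (forall i, measurable (B i)) ->
    P [set t | forall i, B i (Y i t)] = (\prod_(i < n) normal_prob m s (B i))%E.
  move=> mB; have := XY (fun=> setT) B (fun=> measurableT) mB.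
  have -> : [set t | forall i, (fun=> setT) i (X i t) /\ B i (Y i t)] =
      [set t | forall i, B i (Y i t)].
    by apply/seteqP; split => t /= H i; have := H i => // -[].
  move=> ->; rewrite (_ : [set t | _] = setT) ?probability_setT ?mul1e//.
  by apply/seteqP; split.
have mstd : measurable_fun [set: mR] (fun y : mR => (y - m) / s : mR).
  by apply: measurable_funM => //; exact: measurable_funB.
have iidZ : iid_normal P Z.
  split=> [i|B mB]; first by apply: (measurableT_comp mstd); exact: mY.
  have mB' i : measurable ((fun y : mR => (y - m) / s : mR) @^-1` B i).
    by rewrite -[X in measurable X]setTI; exact: mstd.
  apply: (etrans (PY _ mB')); apply: eq_bigr => i _.
  exact: normal_prob_standardize.
pose Xt t : n.-tuple mR := [tuple X i t | i < n].
pose Yt t : n.-tuple mR := [tuple Y i t | i < n].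
have mtuple (W : 'I_n -> T -> mR) : (forall i, measurable_fun setT (W i)) ->
    measurable_fun setT (fun t => [tuple W i t | i < n] : n.-tuple mR).
  move=> mW; apply/measurable_fun_tnthP => i.
  by rewrite (_ : _ \o _ = W i)//; apply/funext => t /=; rewrite tnth_mktuple.
have mXt : measurable_fun setT Xt by exact: mtuple.
have mYt : measurable_fun setT Yt by exact: mtuple.
have box (W : 'I_n -> T -> mR) (A : 'I_n -> set mR) :
    [set t | forall i, A i (tnth [tuple W k t | k < n] i)] =
    [set t | forall i, A i (W i t)].
  by apply/seteqP; split => t /= H i; have := H i; rewrite tnth_mktuple.
have indep : independent_pair P Xt Yt.
  move=> A B mA mB.
  (* First the event on [Yt] is fixed and [Xt] ranges over boxes; then such a box is fixed and [Yt]
     ranges over boxes. *)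
  apply: tuple_indep_event => //.
    by rewrite -[X in measurable X]setTI; exact: mYt.
  move=> A' mA'; rewrite setIC muleC.
  have mAbox : measurable [set t | forall i, A' i (tnth (Xt t) i)].
    by rewrite -[X in measurable X]setTI; exact: (mXt measurableT _ (measurable_box mA')).
  apply: tuple_indep_event => // B' mB'.
  rewrite !box setIC muleC PY// -XY//; congr (P _).
  by apply/seteqP; split => t /=; [move=> [H1 H2] i|move=> H; split => i; have [] := H i].
pose C : set (n.-tuple mR * n.-tuple mR) :=
  [set z | rho < `|sample_corr (tnth z.1) (tnth z.2)|].
have mC : measurable C.
  apply: (measurable_sample_corr_gt
    (f := fun i (z : n.-tuple mR * n.-tuple mR) => tnth z.1 i)
    (g := fun i (z : n.-tuple mR * n.-tuple mR) => tnth z.2 i)) => [|i|i].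
  - exact: ltW.
  - by apply: (measurableT_comp (measurable_tnth i)).
  - by apply: (measurableT_comp (measurable_tnth i)).
have tE (W : 'I_n -> T -> mR) t : tnth [tuple W k t | k < n] = W ^~ t.
  by apply/funext => i; rewrite tnth_mktuple.
have -> : [set t | (rho < `|sample_corr (X ^~ t) (Y ^~ t)|)%R] =
    [set t | C (Xt t, Yt t)].
  by apply/seteqP; split => t; rewrite /C/= !tE.
rewrite (independent_pair_prob mXt mYt indep mC).
apply: (@le_trans _ _ (\int[P]_t (corr_bound n rho)%:E)%E); last first.
  have -> : (\int[P]_t (corr_bound n rho)%:E = (corr_bound n rho)%:E * P setT)%E.
    exact: integral_cst.
  by rewrite probability_setT mule1.
have PC t : (P [set u | C (Xt t, Yt u)] <= (corr_bound n rho)%:E)%E.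
  apply: le_trans (corr_tail_fixed (X ^~ t) n2 rho0 rho1 iidZ).
  rewrite le_eqVlt; apply/orP; left; apply/eqP; congr (P _).
  apply/seteqP; split => u; rewrite /C/= !tE (@sample_corr_affine _ _ _ (Y ^~ u))//;
  exact: leq_trans n2.
apply: ge0_le_integral => //.
have -> : (fun t => P [set u | C (Xt t, Yt u)]) =
    (image_measure P mYt \o xsection C) \o Xt.
  apply/funext => t /=; rewrite /image_measure /pushforward; congr (P _).
  by apply/seteqP; split => u /=; rewrite /xsection/= inE.
by apply: (measurableT_comp _ mXt); exact: measurable_fun_xsection.
Qed.

End correlation_tail.

(** * Union bound over the columns *)

Section max_correlation_tail.
Context {R : realType}.
Notation mR := (measurableTypeR R).

(** With [rho >= 0] the starting value 0 of the maximum never counts as an exceedance, even when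
    [p = 0]. *)
Lemma max_abs_corr_gtE n p (x : 'I_n -> 'I_p -> R) (y : 'I_n -> R) (rho : R) :
  0 <= rho ->
  rho < max_abs_corr x y <-> exists j, rho < `|sample_corr (fun i => x i j) y|.
Proof.
move=> rho0; rewrite ltNge; split.
  move=> /negP H; apply: contrapT => /forallNP H'; apply: H.
  by apply/bigmax_leP; split=> // j _; rewrite leNgt; apply/negP; exact: H'.
move=> [j Hj]; apply/negP => /bigmax_leP[_ /(_ j isT)].
by rewrite leNgt Hj.
Qed.

(** Cauchy-Schwarz: the sum of the squares of [t x_i + u y_i] is nonnegative, and at [t = b],
    [u = - a] it equals [a (a c - b^2)]. *)
Lemma sum_mul_sqr_le n (x y : 'I_n -> R) :
  (\sum_i x i * y i) ^+ 2 <= (\sum_i x i ^+ 2) * (\sum_i y i ^+ 2).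
Proof.
pose a := \sum_i x i ^+ 2; pose b := \sum_i x i * y i; pose c := \sum_i y i ^+ 2.
have a0 : 0 <= a by apply: sumr_ge0 => i _; exact: sqr_ge0.
have H t u : 0 <= t ^+ 2 * a + 2 * (t * u) * b + u ^+ 2 * c.
  rewrite /a /b /c !mulr_sumr -!big_split/=; apply: sumr_ge0 => i _.
  have -> : t ^+ 2 * x i ^+ 2 + 2 * (t * u) * (x i * y i) + u ^+ 2 * y i ^+ 2 =
    (t * x i + u * y i) ^+ 2 by ring.
  exact: sqr_ge0.
rewrite -/a -/b -/c; have [a00|a00] := eqVneq a 0.
  have c0 : 0 <= c by apply: sumr_ge0 => i _; exact: sqr_ge0.
  have bc0 : 0 <= b ^+ 2 * c by rewrite mulr_ge0// sqr_ge0.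
  (* For [a = 0] these values give [- (c + 2) b^2 >= 0], hence [b = 0]. *)
  by have := H (- (c + 1)) b; rewrite a00; lra.
have ap : 0 < a by rewrite lt_neqAle eq_sym a00.
rewrite -(ler_pM2l ap); have := H b (- a); lra.
Qed.

Lemma sample_corr_le1 n (x y : 'I_n -> R) : `|sample_corr x y| <= 1.
Proof.
rewrite leNgt sample_corr_gtE// negb_and mul1r -leNgt -[in X in _ || X]leNgt.
apply/orP; right; rewrite /corr_denominator -sqrtrM; last first.
  by apply: sumr_ge0 => i _; exact: sqr_ge0.
by rewrite -sqrtr_sqr; apply: ler_wsqrtr; exact: sum_mul_sqr_le.
Qed.

Lemma max_abs_corr_le1 n p (x : 'I_n -> 'I_p -> R) (y : 'I_n -> R) :
  max_abs_corr x y <= 1.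
Proof. by apply/bigmax_leP; split=> // j _; exact: sample_corr_le1. Qed.

Lemma measurable_max_abs_corr_gt d (U : measurableType d) n p
    (x : 'I_n -> 'I_p -> U -> R) (y : 'I_n -> U -> R) (rho : R) : 0 <= rho ->
  (forall i j, measurable_fun setT (x i j)) -> (forall i, measurable_fun setT (y i)) ->
  measurable [set u | rho < max_abs_corr (fun i j => x i j u) (y ^~ u)].
Proof.
move=> rho0 mx my.
have -> : [set u | rho < max_abs_corr (fun i j => x i j u) (y ^~ u)] =
    \bigcup_(j in [set: 'I_p]) [set u | rho < `|sample_corr (fun i => x i j u) (y ^~ u)|].
  apply/seteqP; split => u /=.
    by move=> /(max_abs_corr_gtE _ _ rho0)[j Hj]; exists j.
  by move=> [j _ Hj]; apply/(max_abs_corr_gtE _ _ rho0); exists j.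
apply: fin_bigcup_measurable => // j _.
exact: (measurable_sample_corr_gt (f := fun i => x i j)).
Qed.

Context {d0 : measure_display} {T0 : measurableType d0} (P0 : probability T0 R).
Context {d : measure_display} {T : measurableType d} (P : probability T R).
Variables (p n : nat) (X0 : 'I_p -> {RV P0 >-> R}) (Y0 : {RV P0 >-> R}).
Variables (XS : 'I_n -> 'I_p -> {RV P >-> R}) (YS : 'I_n -> {RV P >-> R}).
Hypothesis Y_gaussian : gaussian Y0.
Hypothesis XY_indep : independent_pair P0 (covariates X0) Y0.
Hypothesis sample : iid_sample P0 (observation X0 Y0) P
  (fun i : 'I_n => observation (XS i) (YS i)).

(** Independence across observations gives a product over [i]; independence of covariates and
    response in the population splits each factor. The covariate part is then folded back into one
    probability by taking every [B i] full. *)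
Lemma sample_column_law (j : 'I_p) (A B : 'I_n -> set mR) :
  (forall i, measurable (A i)) -> (forall i, measurable (B i)) ->
  (P [set t | forall i, A i (XS i j t) /\ B i (YS i t)] =
   P [set t | forall i, A i (XS i j t)] *
   \prod_(i < n) P0 (Y0 @^-1` B i))%E.
Proof.
have rect (A' B' : 'I_n -> set mR) :
    (forall i, measurable (A' i)) -> (forall i, measurable (B' i)) ->
    (P [set t | forall i, A' i (XS i j t) /\ B' i (YS i t)] =
    \prod_(i < n) P0 (X0 j @^-1` A' i) * \prod_(i < n) P0 (Y0 @^-1` B' i))%E.
  move=> mA mB; have [ind law] := sample.
  have mS i : measurable ([set c : p.-tuple mR | A' i (tnth c j)]).
    by rewrite -[X in measurable X]setTI; exact: (measurable_tnth j).
  have mSB i : measurable ([set c : p.-tuple mR | A' i (tnth c j)] `*` B' i).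
    exact: measurableX.
  have := ind (finset.setTfor 'I_n) (fun i => [set c : p.-tuple mR | A' i (tnth c j)] `*` B' i)
    (fun i _ => mSB i).
  have -> : \bigcap_(i in [set` finset.setTfor 'I_n])
      observation (XS i) (YS i) @^-1`
       ([set c | A' i (tnth c j)] `*` B' i) =
      [set t | forall i, A' i (XS i j t) /\ B' i (YS i t)].
    apply/seteqP; split => t /= H i.
      by have := H i (finset.in_setT i); rewrite /= tnth_mktuple.
    by move=> _ /=; rewrite tnth_mktuple.
  move=> ->; rewrite -big_split/=.
  apply: eq_big => [i|i _]; first by rewrite finset.in_setT.
  apply: (etrans (law i _ (mSB i))); apply: (etrans (XY_indep (mS i) (mB i))).
  congr (P0 _ * _)%E.
  by apply/seteqP; split => t /=; rewrite tnth_mktuple.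
move=> mA mB; rewrite rect//; congr (_ * _)%E.
have := rect A (fun=> setT) mA (fun=> measurableT).
rewrite [X in (_ * X)%E]big1 ?mule1; last first.
  by move=> i _; rewrite preimage_setT probability_setT.
move=> <-; congr (P _); apply/seteqP; split => t /= H i; first by have [] := H i.
by split; [exact: H|].
Qed.

Lemma max_abs_corr_tail (rho : R) : (2 < n)%N -> 0 < rho -> rho < 1 ->
  (P [set t | (rho < max_abs_corr (fun i j => XS i j t) (fun i => YS i t))%R] <=
   (p%:R * corr_bound n rho)%:E)%E.
Proof.
move=> n2 rho0 rho1; have [m [s [s0 Ylaw]]] := Y_gaussian.
pose E (j : 'I_p) := [set t | rho < `|sample_corr (fun i => XS i j t) (YS ^~ t)|].
have mE j : measurable (E j).
  by apply: (measurable_sample_corr_gt (f := fun i => XS i j)); first exact: ltW.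
have PE j : (P (E j) <= (corr_bound n rho)%:E)%E.
  apply: (@corr_tail _ _ _ P n (fun i => XS i j) (fun i => YS i) m s rho) => //.
  - by move=> i; exact: (measurable_funPT (XS i j)).
  - by move=> i; exact: (measurable_funPT (YS i)).
  move=> A B mA mB; apply: (etrans (sample_column_law j mA mB)).
  congr (_ * _)%E.
  by apply: eq_bigr => i _; rewrite -Ylaw.
(* Boole's inequality is applied to a sequence over [nat]; indices from [p] on receive the empty
   set. *)
pose F (k : nat) := if insub k is Some j then E j else set0.
have FE (j : 'I_p) : F j = E j by rewrite /F valK.
have mF k : measurable (F k) by rewrite /F; case: insub.
have -> : [set t | (rho < max_abs_corr (fun i j => XS i j t) (fun i => YS i t))%R] =
    \big[setU/set0]_(j < p) F j.
  apply/seteqP; split => t /=.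
    move=> /(max_abs_corr_gtE _ _ (ltW rho0))[j Hj].
    by rewrite -bigcup_mkord; exists j => //=; rewrite FE.
  rewrite -bigcup_mkord => -[k /= kp].
  rewrite -[k]/(nat_of_ord (Ordinal kp)) FE => Hj.
  by apply/(max_abs_corr_gtE _ _ (ltW rho0)); exists (Ordinal kp).
apply: le_trans (Boole_inequality _ _) _ => //.
apply: (@le_trans _ _ (\sum_(j < p) (corr_bound n rho)%:E)%E).
  by apply: lee_sum => j _; rewrite FE; exact: PE.
by rewrite sumEFin sumr_const card_ord mulr_natl.
Qed.

End max_correlation_tail.

(** * The threshold *)

Section threshold.
Context {R : realType}.
Implicit Types p n : nat.

Definition threshold p n : R := 1 - p%:R `^ (- (2 / (n%:R - 2))).

(** The variables [p] and [n] sit in separate summands, so the double limit needs no relation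
    between their rates. *)
Definition tail_bound p n : R := 12 * Num.sqrt ((2 * ln p%:R)^-1 + (n - 2)%:R^-1).

Lemma threshold_expR p n : (0 < p)%N -> (2 < n)%N ->
  threshold p n = 1 - expR (- (2 * ln p%:R / (n - 2)%:R)).
Proof.
move=> p0 n2; rewrite /threshold /powR pnatr_eq0 -[p == 0%N]negbK -lt0n p0/=.
by rewrite (natrB _ (ltnW n2)); congr (1 - expR _); ring.
Qed.

Lemma ln_nat_gt0 p : (1 < p)%N -> 0 < ln p%:R :> R.
Proof. by move=> p1; rewrite ln_gt0// ltr1n. Qed.

Lemma threshold_gt0 p n : (1 < p)%N -> (2 < n)%N -> 0 < threshold p n.
Proof.
move=> p1 n2; rewrite (threshold_expR (ltnW p1) n2) subr_gt0 expR_lt1 oppr_lt0.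
by rewrite divr_gt0 ?mulr_gt0 ?ln_nat_gt0// ltr0n subn_gt0.
Qed.

Lemma threshold_lt1 p n : (0 < p)%N -> (2 < n)%N -> threshold p n < 1.
Proof.
by move=> p0 n2; rewrite threshold_expR// ltrBlDr ltrDl expR_gt0.
Qed.

Lemma corr_bound_threshold p n : (1 < p)%N -> (2 < n)%N ->
  p%:R * corr_bound n (Num.sqrt (threshold p n)) <= tail_bound p n.
Proof.
move=> p1 n2; have p0 : (0 < p)%N by exact: ltnW.
have t0 := threshold_gt0 p1 n2.
have pR : 0 < p%:R :> R by rewrite ltr0n.
have kR : 0 < (n - 2)%:R :> R by rewrite ltr0n subn_gt0.
have lp := ln_nat_gt0 p1.
rewrite /corr_bound sqr_sqrtr ?(ltW t0)//.
have tE := threshold_expR p0 n2.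
(* Chosen so that [1 - threshold p n = exp(-y)]; the power [n - 2] of its square root is
   [exp(- ln p)]. *)
set y := 2 * ln p%:R / (n - 2)%:R in tE.
have y0 : 0 < y by rewrite divr_gt0// mulr_gt0.
have -> : Num.sqrt (1 - threshold p n) ^+ (n - 2) = p%:R^-1.
  rewrite tE subKr (_ : expR (- y) = expR (- y / 2) ^+ 2); last first.
    by rewrite -expRM_natl; congr expR; field.
  rewrite sqrtr_sqr ger0_norm ?expR_ge0// -expRM_natl.
  rewrite (_ : (n - 2)%:R * (- y / 2) = - ln p%:R); first by rewrite expRN lnK// posrE.
  by rewrite /y; field; rewrite gt_eqF.
rewrite mulrA divff ?gt_eqF// mul1r -sqrtrM ?(ltW t0)// /tail_bound ler_pM2l//.
rewrite -sqrtrV ?mulr_ge0 ?(ltW t0)// ?(ltW kR)//; apply: ler_wsqrtr.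
(* From [exp y >= 1 + y]. As [y (n - 2) = 2 ln p], the reciprocal of [y (n - 2) / (1 + y)] is the
   sum under the root in [tail_bound]. *)
have ty : y / (1 + y) <= threshold p n.
  rewrite tE expRN.
  have e1 : (expR y)^-1 <= (1 + y)^-1.
    by rewrite lef_pV2 ?posrE ?expR_gt0 ?expR_ge1Dx//; lra.
  rewrite (_ : y / (1 + y) = 1 - (1 + y)^-1); first by lra.
  by field; lra.
apply: (@le_trans _ _ (y / (1 + y) * (n - 2)%:R)^-1).
  by rewrite lef_pV2 ?posrE ?mulr_gt0 ?invr_gt0 ?ler_pM2r//; lra.
rewrite le_eqVlt; apply/orP; left; apply/eqP.
rewrite /y; field.
by rewrite !gt_eqF ?addr_gt0 ?mulr_gt0.
Qed.

Lemma cvg_ln_nat : ln (p%:R : R) @[p --> \oo] --> +oo.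
Proof.
apply/cvgryPge => A; near=> p.
have pA : expR A <= p%:R :> R by near: p; exact: nbhs_infty_ger.
by rewrite -[A]expRK ler_ln ?posrE ?expR_gt0// (lt_le_trans _ pA)// expR_gt0.
Unshelve. all: by end_near. Qed.

Lemma cvg_ln_natV (c : R) : 0 < c -> (c * ln (p%:R : R))^-1 @[p --> \oo] --> (0 : R).
Proof.
move=> c0; apply/gtr0_cvgV0.
  near=> p; rewrite mulr_gt0// ln_nat_gt0//.
  by near: p; exact: nbhs_infty_gt.
apply/cvgryPge => A; near=> p.
rewrite mulrC -ler_pdivrMr//; near: p.
by have /cvgryPge := cvg_ln_nat; apply.
Unshelve. all: by end_near. Qed.

Lemma cvg_subn_natV m : (n - m)%:R^-1 @[n --> \oo] --> (0 : R).
Proof.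
apply/gtr0_cvgV0.
  by near=> n; rewrite ltr0n subn_gt0; near: n; exact: nbhs_infty_gt.
apply/cvgryPge => A; near=> n.
have : A + m%:R <= n%:R by near: n; exact: nbhs_infty_ger.
rewrite -lerBrDr => /le_trans; apply.
by rewrite natrB//; near: n; exact: nbhs_infty_ge.
Unshelve. all: by end_near. Qed.

Lemma cvg_tail_bound : tail_bound pn.1 pn.2 @[pn --> (\oo, \oo)] --> (0 : R).
Proof.
rewrite -[X in _ --> X](mulr0 12); apply: cvgM; first exact: cvg_cst.
rewrite -[X in _ --> X]sqrtr0; apply: continuous_cvg; first exact: sqrt_continuous.
rewrite -[X in _ --> X](addr0 0); apply: cvgD.
  exact: (cvg_comp _ _ cvg_fst (cvg_ln_natV (ltr0n R 2))).
exact: (cvg_comp _ _ cvg_snd (cvg_subn_natV 2)).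
Qed.

End threshold.

Theorem corollary1 (R : realType)
  (* the population (X_1, ..., X_p, Y), for every p and n *)
  (d0 : nat -> nat -> measure_display)
  (T0 : forall p n : nat, measurableType (d0 p n))
  (P0 : forall p n : nat, probability (T0 p n) R)
  (X0 : forall p n : nat, 'I_p -> {RV (P0 p n) >-> R})
  (Y0 : forall p n : nat, {RV (P0 p n) >-> R})
  (* the n observations: XS p n i j is X_j of observation i *)
  (d : nat -> nat -> measure_display)
  (T : forall p n : nat, measurableType (d p n))
  (P : forall p n : nat, probability (T p n) R)
  (XS : forall p n : nat, 'I_n -> 'I_p -> {RV (P p n) >-> R})
  (YS : forall p n : nat, 'I_n -> {RV (P p n) >-> R})
  (Y_gaussian : forall p n : nat, gaussian (Y0 p n))
  (XY_indep : forall p n : nat,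
     independent_pair (P0 p n) (covariates (X0 p n)) (Y0 p n))
  (sample : forall p n : nat,
     iid_sample (P0 p n) (observation (X0 p n) (Y0 p n))
       (P p n) (fun i : 'I_n => observation (XS p n i) (YS p n i)))
  (well_defined : forall p n : nat, (3 <= n)%N -> forall j : 'I_p,
     {ae P p n, forall t : T p n,
       corr_denominator (fun i => XS p n i j t) (fun i => YS p n i t) != 0}) :
  let M (p n : nat) (t : T p n) : R :=
    max_abs_corr (fun i j => XS p n i j t) (fun i => YS p n i t) in
  (forall delta : R, 0 < delta ->
     ereal_sup [set P p n [set t | M p n t >
         Num.sqrt ((1 + delta) * (1 - p%:R `^ (- (2 / (n%:R - 2)))))]
       | n in [set n : nat | (3 <= n)%N]] @[p --> \oo] --> 0%E) /\
  (P pn.1 pn.2 [set t | M pn.1 pn.2 t <=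
      Num.sqrt (1 - pn.1%:R `^ (- (2 / (pn.2%:R - 2))))]
    @[pn --> (\oo, \oo)] --> 1%E).
Proof.
move=> M.
have mM p n (r : R) : 0 <= r -> measurable [set t : T p n | r < M p n t].
  by move=> r0; apply: (measurable_max_abs_corr_gt (x := XS p n) (y := YS p n)).
have tail p n : (1 < p)%N -> (2 < n)%N ->
    (P p n [set t | (Num.sqrt (threshold p n) < M p n t)%R] <= (tail_bound p n)%:E)%E.
  move=> p1 n2; have t0 : 0 < threshold p n :> R by exact: threshold_gt0.
  apply: (@le_trans _ _ (p%:R * corr_bound n (Num.sqrt (threshold p n)))%:E); last first.
    by rewrite lee_fin corr_bound_threshold.
  apply: (max_abs_corr_tail (Y_gaussian p n) (XY_indep p n) (sample p n)) => //.
    by rewrite sqrtr_gt0.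
  by rewrite -[ltRHS]sqrtr1 ltr_sqrt// threshold_lt1// ltnW.
split=> [delta delta0|].
  (* With [y = 2 ln p / (n - 2)], the condition [(1 + delta) (1 - exp(-y)) < 1] says [y < L], so
     [1 / (n - 2) < L / (2 ln p)]; [B] is [tail_bound] after this replacement. *)
  pose L : R := ln ((1 + delta) / delta).
  have L0 : 0 < L by rewrite ln_gt0// ltr_pdivlMr//; lra.
  pose B p : R := 12 * Num.sqrt ((1 + L) * (2 * ln p%:R)^-1).
  have cvgB : B p @[p --> \oo] --> (0 : R).
    rewrite -[X in _ --> X](mulr0 12); apply: cvgM; first exact: cvg_cst.
    rewrite -[X in _ --> X]sqrtr0; apply: continuous_cvg; first exact: sqrt_continuous.
    rewrite -[X in _ --> X](mulr0 (1 + L)); apply: cvgM; first exact: cvg_cst.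
    exact: cvg_ln_natV.
  have tailB p n : (1 < p)%N -> (2 < n)%N ->
      (P p n [set t | (Num.sqrt ((1 + delta) * threshold p n) < M p n t)%R] <= (B p)%:E)%E.
    move=> p1 n2; have t0 : 0 < threshold p n :> R by exact: threshold_gt0.
    have lp : 0 < ln p%:R :> R by exact: ln_nat_gt0.
    have kR : 0 < (n - 2)%:R :> R by rewrite ltr0n subn_gt0.
    have [t1|t1] := leP 1 ((1 + delta) * threshold p n).
      rewrite (_ : [set t | _] = set0) ?measure0 ?lee_fin ?mulr_ge0 ?sqrtr_ge0//.
      apply/seteqP; split=> t //=; apply/negP; rewrite -leNgt.
      apply: le_trans (max_abs_corr_le1 _ _) _.
      by rewrite -[leLHS]sqrtr1; exact: ler_wsqrtr.
    apply: (@le_trans _ _ (P p n [set t | (Num.sqrt (threshold p n) < M p n t)%R])).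
      apply: le_measure; rewrite ?inE; [exact: mM|exact: mM|].
      move=> t /=; apply: le_lt_trans; apply: ler_wsqrtr.
      by rewrite ler_peMl ?(ltW t0)//; lra.
    apply: (le_trans (tail _ _ p1 n2)); rewrite lee_fin ler_pM2l//.
    apply: ler_wsqrtr; rewrite [leRHS]mulrDl mul1r lerD2l.
    have : 2 * ln p%:R / (n - 2)%:R < L.
      move: t1; rewrite (threshold_expR (ltnW p1) n2) => t1.
      rewrite -ltr_expR lnK ?posrE ?divr_gt0//; last by lra.
      rewrite -[ltLHS]invrK -expRN -[ltRHS]invrK.
      rewrite ltf_pV2 ?posrE ?expR_gt0 ?invr_gt0 ?divr_gt0//; last by lra.
      by rewrite invf_div ltr_pdivrMr; lra.
    rewrite ltr_pdivrMr// => H.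
    rewrite ler_pdivlMr ?mulr_gt0// mulrC ler_pdivrMr//.
    exact: ltW.
  apply: (@squeeze_cvge _ _ _ _ (cst 0%E) _ (EFin \o B)).
  - near=> p; apply/andP; split.
      (* The member [n = 3] shows that the family is nonempty; an empty supremum would be minus
         infinity. *)
      apply: le_trans (ereal_sup_ubound _); last by exists 3%N.
      exact: measure_ge0.
    apply: ge_ereal_sup => _ [n n3 <-]; apply: tailB => //.
    by near: p; exact: nbhs_infty_gt.
  - exact: cvg_cst.
  - by apply: cvg_EFin => //; exact: nearW.
have MC p n : [set t : T p n | M p n t <= Num.sqrt (threshold p n)] =
    ~` [set t : T p n | Num.sqrt (threshold p n) < M p n t].
  by apply/seteqP; split=> t /=; rewrite leNgt => /negP.
apply: (@squeeze_cvge _ _ _ _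
  (fun pn => (1 - tail_bound pn.1 pn.2)%:E) _ (cst 1%E)).
- near=> pn; apply/andP; split; last first.
    by apply: probability_le1; rewrite MC; apply: measurableC; exact: mM.
  have p1 : (1 < pn.1)%N by near: pn; exact: (@cvg_fst _ _ \oo \oo _ _ (nbhs_infty_gt 1)).
  have n2 : (2 < pn.2)%N by near: pn; exact: (@cvg_snd _ _ \oo \oo _ _ (nbhs_infty_gt 2)).
  rewrite -/(threshold pn.1 pn.2) MC probability_setC; last exact: mM.
  by rewrite EFinB leeB// tail.
- rewrite -[X in X%:E](subr0 1); apply: cvg_EFin; first exact: nearW.
  apply: cvgB; first exact: cvg_cst.
  exact: cvg_tail_bound.
- exact: cvg_cst.
Unshelve. all: by end_near. Qed.
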